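(* If a group $G$ has a well-defined (i.e. finite-valued) extrinsic tame filling function $f:\mathbb N[\frac14]\to\mathbb N[\frac14]$ over some finite presentation, then $G$ is tame combable.
   Context: Conventions: $\mathbb N=\{0,1,2,\ldots\}$ and $\mathbb N[\frac14]=\{n/4: n\in\mathbb N\}$. Every finite presentation $\mathcal P=\langle A\mid R\rangle$ of a group $G$ is assumed symmetric: $A$ is finite and closed under inversion, no $a\in A$ represents the identity $\epsilon$ of $G$, and $R$ is a finite subset of $A^*\setminus\{1\}$ ($1$ = empty word) closed under inversion and cyclic conjugation (relators need not be freely reduced, but the freely reduced form of each relator, if nonempty, is also in $R$). $v=_G w$ means that $v,w$ represent the same element of $G$. $X$ is the Cayley 2-complex of $\mathcal P$; its 1-skeleton $X^{(1)}$ is the Cayley graph of $G$ with respect to $A$, in which the directed edge $e_{g,a}$ from $g$ to $ga$ labeled $a$ and the edge $e_{ga,a^{-1}}$ have the same underlying undirected edge. $d_Y$ denotes the path metric on the 1-skeleton of a 2-complex $Y$. Van Kampen diagrams: for $w\in A^*$ with $w=_G\epsilon$, a van Kampen diagram for $w$ over $\mathcal P$ is a finite, planar, contractible combinatorial 2-complex $\Delta$ with edges directed and labeled by elements of $A$, with a basepoint vertex $*$ on the boundary $\partial\Delta$, such that $\partial\Delta$ read counterclockwise from $*$ is an edge path labeled $w$ and every 2-cell has boundary labeled by an element of $R$ (diagrams need not be reduced). $\pi_\Delta:\Delta\to X$ is the cellular map with $\pi_\Delta( * )=\epsilon$ mapping $n$-cells to $n$-cells and preserving edge and 2-cell boundary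 labels and orientations. Coarse distance: for a combinatorial 2-complex $Y$ with basepoint vertex $y$ and $p\in Y$, $\widetilde d_Y(y,p)$ is: $d_Y(y,p)$ if $p$ is a vertex; $\min\{\widetilde d_Y(y,v)\mid v\in\partial(e)\}+\frac12$ if $p$ is in the interior of an edge $e$; $\max\{\widetilde d_Y(y,q)\mid q\in\partial(\sigma)\setminus Y^{(0)}\}-\frac14$ if $p$ is in the interior of a 2-cell $\sigma$. 1-combing: for a subcomplex $Z$ of $Y^{(1)}$, a 1-combing of the pair $(Y,Z)$ at a basepoint $y_0\in Y$ is a continuous function $\Psi:Z\times[0,1]\to Y$ with (C1) $\Psi(p,0)=y_0$ and $\Psi(p,1)=p$ for all $p\in Z$; (C2) if $y_0\in Z$ then $\Psi(y_0,t)=y_0$ for all $t$; (C3) if $p\in Z^{(0)}$ then $\Psi(p,t)\in Y^{(1)}$ for all $t$. Tameness: for a 1-complex $Z'$, a continuous function $\psi:Z'\times[0,1]\to Y$ is $f$-tame, for a nondecreasing $f:\mathbb N[\frac14]\to\mathbb N[\frac14]$, if $\widetilde d_Y(y,\psi(p,s))\le f(\widetilde d_Y(y,\psi(p,t)))$ for all $p\in Z'$ and $0\le s<t\le1$, where $y$ is the basepoint of $Y$ ($*$ for a van Kampen diagram, $\epsilon$ for $X$). Extrinsic tame filling function: a nondecreasing $f:\mathbb N[\frac14]\to\mathbb N[\frac14]$ is an extrinsic tame filling function for $G$ over $\mathcal P$ if for every $w\in A^*$ with $w=_G\epsilon$ there exist a van Kampen diagram $\Delta$ for $w$ over $\mathcal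 P$ with basepoint $*$ and a 1-combing $\Psi:\partial\Delta\times[0,1]\to\Delta$ of $(\Delta,\partial\Delta)$ at $*$ such that $\pi_\Delta\circ\Psi$ is $f$-tame. Tame combable: $G$ is tame combable if there is a Cayley complex $X$ for $G$ with respect to some finite presentation, with a 1-combing $\Psi$ of $(X,X^{(1)})$ at $\epsilon$ such that whenever $\tau$ is a 0- or 1-cell in $X$ and $C$ is a compact subset of $X$, there is a compact set $D$ in $X$ such that $\Psi^{-1}(C)\cap(\tau\times[0,1])$ is contained in a single path component of $\Psi^{-1}(D)\cap(\tau\times[0,1])$. *)

(* Defs.v *)
From HB Require Import structures.
From Stdlib Require Export Relations.
From mathcomp Require Export all_boot all_order all_algebra.
From mathcomp Require Export all_classical all_reals all_analysis.
Export numFieldNormedType.Exports.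
Export Order.TTheory GRing.Theory Num.Theory.

Set Implicit Arguments.
Unset Strict Implicit.
Unset Printing Implicit Defensive.

#[global] Open Scope classical_set_scope.
#[global] Open Scope ring_scope.

(* Combinatorial 2-complexes, described by directed edges ("darts").  A dart
   and its reverse [dinv] are the two orientations of one undirected edge;
   the 2-cell [f] is attached along the closed edge path [fbd f], which starts
   at the vertex [fbase f]. *)
Section EdgePaths.
Variables (V D : Type) (org : D -> V) (dinv : D -> D).

Fixpoint is_epath (v : V) (p : seq D) (w : V) : Prop :=
  if p is d :: p' then org d = v /\ is_epath (org (dinv d)) p' w else v = w.

End EdgePaths.

Record complex2 := Complex2 {
  vert : choiceType;
  dart : choiceType;
  face : choiceType;
  org : dart -> vert;
  dinv : dart -> dart;
  fbase : face -> vert;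
  fbd : face -> seq dart;
  dinvK : involutive dinv;
  dinv_neq : forall d, dinv d <> d;
  fbd_nonnil : forall f, fbd f <> [::];
  fbd_closed : forall f, is_epath org dinv (fbase f) (fbd f) (fbase f) }.

Definition tgt (K : complex2) (d : dart K) : vert K := org (dinv d).

Definition epath (K : complex2) : vert K -> seq (dart K) -> vert K -> Prop :=
  is_epath (@org K) (@dinv K).

Definition finite_complex (K : complex2) : Prop :=
  [/\ finite_set [set: vert K], finite_set [set: dart K] &
      finite_set [set: face K]].

(* The geometric realization is the quotient of the disjoint union of the
   vertices, a copy of [0,1] for each dart and a closed unit disc for each
   2-cell.  So that the characteristic maps are total, the parameters range
   over all of R (resp. R * R), and a parameter outside [0,1] (resp. outside the
   disc) denotes its retraction onto the nearest end (resp. radially onto the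
   unit circle). *)
Inductive prept (R : realType) (K : complex2) :=
  | PV of vert K
  | PE of dart K & R
  | PF of face K & R * R.
Arguments PV {R K}.
Arguments PE {R K}.
Arguments PF {R K}.

HB.instance Definition _ (R : realType) (K : complex2) :=
  gen_eqMixin (prept R K).
HB.instance Definition _ (R : realType) (K : complex2) :=
  gen_choiceMixin (prept R K).

(* The point at parameter u in [0, size p] on the edge path p from v, each
   edge being run through in unit time. *)
Fixpoint path_pre (R : realType) (K : complex2) (v : vert K)
    (p : seq (dart K)) (u : R) : prept R K :=
  if p is d :: p' then
    if u <= 1 then PE d u else path_pre (tgt d) p' (u - 1)
  else PV v.

Inductive glue (R : realType) (K : complex2) : prept R K -> prept R K -> Prop :=
  | glue_org d t : t <= 0 -> glue (PE d t) (PV (org d))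
  | glue_inv d t : glue (PE d t) (PE (dinv d) (1 - t))
  | glue_bd f r s : 1 <= r -> 0 <= s <= 1 ->
      glue (PF f (r * cos (2 * pi * s), r * sin (2 * pi * s)))
           (path_pre (fbase f) (fbd f) ((size (fbd f))%:R * s)).

Definition glued (R : realType) (K : complex2) (x y : prept R K) : bool :=
  `[< clos_refl_sym_trans _ (@glue R K) x y >].

Lemma glued_refl (R : realType) (K : complex2) : reflexive (@glued R K).
Proof. by move=> x; apply/asboolP; exact: rst_refl. Qed.

Lemma glued_sym (R : realType) (K : complex2) : symmetric (@glued R K).
Proof.
by move=> x y; apply/idP/idP => /asboolP h; apply/asboolP; exact: rst_sym.
Qed.

Lemma glued_trans (R : realType) (K : complex2) : transitive (@glued R K).
Proof.
by move=> y x z /asboolP h1 /asboolP h2; apply/asboolP; exact: rst_trans h2.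
Qed.

Canonical glued_equiv (R : realType) (K : complex2) :=
  EquivRel (@glued R K) (@glued_refl R K) (@glued_sym R K) (@glued_trans R K).

Definition realization (R : realType) (K : complex2) :=
  {eq_quot (@glued_equiv R K)}%qT.

HB.instance Definition _ (R : realType) (K : complex2) :=
  Choice.on (realization R K).

Definition vpt (R : realType) (K : complex2) (v : vert K) : realization R K :=
  \pi_({eq_quot (@glued_equiv R K)})%qT (PV v).
Definition ept (R : realType) (K : complex2) (d : dart K) (t : R) :
    realization R K :=
  \pi_({eq_quot (@glued_equiv R K)})%qT (PE d t).
Definition fpt (R : realType) (K : complex2) (f : face K) (z : R * R) :
    realization R K :=
  \pi_({eq_quot (@glued_equiv R K)})%qT (PF f z).
Definition path_pt (R : realType) (K : complex2) (v : vert K)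
    (p : seq (dart K)) (u : R) : realization R K :=
  \pi_({eq_quot (@glued_equiv R K)})%qT (path_pre v p u).
Arguments vpt R {K} v.

(* The weak topology of the cell structure.  As [ept d] and [fpt f] factor
   through the retractions onto [0,1] and the disc, these preimages are open
   iff their traces on [0,1] and on the disc are relatively open. *)
Definition cw_open (R : realType) (K : complex2) : set_system (realization R K) :=
  [set U | (forall d, open (@ept R K d @^-1` U)) /\
           (forall f, open (@fpt R K f @^-1` U))].

Lemma cw_openT (R : realType) (K : complex2) : @cw_open R K setT.
Proof. by split=> ?; rewrite preimage_setT; exact: openT. Qed.

Lemma cw_openI (R : realType) (K : complex2) : setI_closed (@cw_open R K).
Proof.
by move=> A B [A1 A2] [B1 B2]; split=> ?; rewrite preimage_setI; exact: openI.
Qed.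

Lemma cw_open_bigU (R : realType) (K : complex2) (I : Type)
    (f : I -> set (realization R K)) :
  (forall i, cw_open (f i)) -> cw_open (\bigcup_i f i).
Proof.
by move=> h; split=> ?; rewrite preimage_bigcup; apply: bigcup_open => i _;
  have [] := h i.
Qed.

HB.instance Definition _ (R : realType) (K : complex2) :=
  @isOpenTopological.Build (realization R K) (@cw_open R K)
    (@cw_openT R K) (@cw_openI R K) (@cw_open_bigU R K).

Section Geometry.
Variable R : realType.

Definition skel1 (K : complex2) : set (realization R K) :=
  [set x | (exists v, x = vpt R v) \/ (exists d t, x = ept d t)].

Definition closed_cell01 (K : complex2) (tau : set (realization R K)) : Prop :=
  (exists v, tau = [set vpt R v]) \/ (exists d : dart K, tau = @ept R K d @` `[0, 1]).

Definition edge_dist (K : complex2) (u v : vert K) : R :=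
  inf [set ((size p)%:R : R) | p in [set p | epath u p v]].

Definition coarse_edge (K : complex2) (y : vert K) (d : dart K) : R :=
  Num.min (edge_dist y (org d)) (edge_dist y (tgt d)) + 1 / 2.

(* [coarse y x q] : the coarse distance from the vertex y to the point x is q.
   On a 2-cell, every point of its boundary other than a vertex lies in the
   interior of some edge of the boundary path, so that the maximum runs over
   these edges (the values are positive, hence the default 0 is harmless). *)
Inductive coarse (K : complex2) (y : vert K) : realization R K -> R -> Prop :=
  | coarse_vert v : coarse y (vpt R v) (edge_dist y v)
  | coarse_open_edge d t : 0 < t < 1 -> coarse y (ept d t) (coarse_edge y d)
  | coarse_open_face f z : z.1 ^+ 2 + z.2 ^+ 2 < 1 ->
      coarse y (fpt f z)
        (\big[Num.max/0]_(d <- fbd f) coarse_edge y d - 1 / 4).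

Definition combing1 (K : complex2) (Z : set (realization R K))
    (y0 : realization R K) (Psi : realization R K * R -> realization R K) : Prop :=
  [/\ {within Z `*` `[0, 1], continuous Psi},
      (forall p, Z p -> Psi (p, 0) = y0 /\ Psi (p, 1) = p),
      (Z y0 -> forall t, 0 <= t <= 1 -> Psi (y0, t) = y0) &
      (forall v, Z (vpt R v) -> forall t, 0 <= t <= 1 ->
         skel1 (Psi (vpt R v, t)))].

Definition quarters : set R := [set q | exists n : nat, q = n%:R / 4].

(* f represents a nondecreasing function from N[1/4] to N[1/4]; its values
   outside N[1/4] are irrelevant. *)
Definition quarter_fun (f : R -> R) : Prop :=
  (forall q, quarters q -> quarters (f q)) /\
  (forall q r, quarters q -> quarters r -> q <= r -> f q <= f r).

Definition tame (f : R -> R) (T : Type) (Z : set T) (K : complex2) (y : vert K)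
    (psi : T * R -> realization R K) : Prop :=
  forall p s t a b, Z p -> 0 <= s -> s < t -> t <= 1 ->
    coarse y (psi (p, s)) a -> coarse y (psi (p, t)) b -> a <= f b.

Definition path_component (T : topologicalType) (S : set T) (x : T) : set T :=
  [set y | exists g : R -> T, [/\ {within `[0, 1], continuous g},
     g 0 = x, g 1 = y & forall t, 0 <= t <= 1 -> S (g t)]].

Definition contractible (T : topologicalType) : Prop :=
  exists (x0 : T) (H : T * R -> T),
    [/\ {within [set: T] `*` `[0, 1], continuous H},
        forall x, H (x, 0) = x & forall x, H (x, 1) = x0].

Definition embedding (T U : topologicalType) (i : T -> U) : Prop :=
  [/\ continuous i, injective i &
      forall A, open A -> exists2 B, open B & A = i @^-1` B].

(* The loop [c] in the plane, parametrized by [0,1], winds exactly once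
   counterclockwise around the point x. *)
Definition winds_once_ccw (x : R * R) (c : R -> R * R) : Prop :=
  exists rho theta : R -> R,
    [/\ {within `[0, 1], continuous theta}, theta 1 = theta 0 + 2 * pi &
        forall t, 0 <= t <= 1 -> 0 < rho t /\
          c t = (x.1 + rho t * cos (theta t), x.2 + rho t * sin (theta t))].

(* For a planar complex embedded by i, the closed edge path p from v is the
   boundary read counterclockwise: the complement of the image is an open
   annulus h (]1, +oo[ x [0, 1[), in polar coordinates (radius, turn), and h
   extends continuously to radius 1, where it reads p at constant speed. *)
Definition reads_boundary_ccw (K : complex2) (i : realization R K -> R * R)
    (v : vert K) (p : seq (dart K)) : Prop :=
  exists h : R * R -> R * R,
    [/\ {within `[1, +oo[ `*` `[0, 1], continuous h},
        set_bij (`]1, +oo[ `*` `[0, 1[) (~` range i) h,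
        (forall r, 1 <= r -> h (r, 0) = h (r, 1)),
        (forall t, 0 <= t <= 1 ->
           h (1, t) = i (path_pt v p ((size p)%:R * t))) &
        winds_once_ccw (i (vpt R v)) (fun t => h (2, t))].

End Geometry.

Section Words.
Variables (A : eqType) (ainv : A -> A).

Definition inv_word (w : seq A) : seq A := rev (map ainv w).

Definition free_red (w : seq A) : seq A :=
  foldr (fun a u => if u is b :: u' then
                      if b == ainv a then u' else a :: u
                    else [:: a]) [::] w.

Inductive word_move (rel : seq (seq A)) : seq A -> seq A -> Prop :=
  | move_free u v a : word_move rel (u ++ a :: ainv a :: v) (u ++ v)
  | move_rel u v r : r \in rel -> word_move rel (u ++ r ++ v) (u ++ v).

End Words.

Definition word_val (G : groupType) (A : Type) (val : A -> G) (w : seq A) : G :=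
  foldr (fun a g => (val a * g)%g) 1%g w.

(* Symmetric finite presentations of G.  Formal inversion of letters may have
   fixed points, that is, a generator may be its own inverse letter. *)
Record presentation (G : groupType) := Presentation {
  gens : finType;
  ginv : gens -> gens;
  gval : gens -> G;
  rels : seq (seq gens);
  ginvK : involutive ginv;
  gval_inv : forall a, gval (ginv a) = ((gval a)^-1)%g;
  gval_neq1 : forall a, gval a <> 1%g;
  gval_gen : forall g, exists w, word_val gval w = g;
  gval_rel : forall w, word_val gval w = 1%g <->
    clos_refl_sym_trans _ (word_move ginv rels) w [::];
  rels_nonnil : forall r, r \in rels -> r <> [::];
  rels_inv : forall r, r \in rels -> inv_word ginv r \in rels;
  rels_rot : forall r n, r \in rels -> rot n r \in rels;
  rels_red : forall r, r \in rels -> free_red ginv r <> [::] ->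
    free_red ginv r \in rels }.

Section Cayley.
Variables (G : groupType) (P : presentation G).

Definition cay_org (d : G * gens P) : G := d.1.
Definition cay_inv (d : G * gens P) : G * gens P :=
  ((d.1 * gval d.2)%g, ginv d.2).

Fixpoint cay_path (g : G) (w : seq (gens P)) : seq (G * gens P) :=
  if w is a :: w' then (g, a) :: cay_path (g * gval a)%g w' else [::].

Lemma cay_invK : involutive cay_inv.
Proof. by move=> [g a]; rewrite /cay_inv /= gval_inv mulgK ginvK. Qed.

Lemma cay_inv_neq d : cay_inv d <> d.
Proof.
case: d => g a [h _]; apply: (gval_neq1 (a := a)).
by apply: (mulgI g); rewrite mulg1.
Qed.

Lemma cay_path_nonnil (x : G * seq_sub (rels P)) :
  cay_path x.1 (ssval x.2) <> [::].
Proof.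
case: x => g [r rP] /=.
by have := rels_nonnil rP; case: r {rP} => // a r _.
Qed.

Lemma cay_path_end g w :
  is_epath cay_org cay_inv g (cay_path g w) (g * word_val (@gval G P) w)%g.
Proof.
elim: w g => [|a w IH] g /=; first by rewrite mulg1.
by split=> //; rewrite mulgA; exact: IH.
Qed.

Lemma rel_val r : r \in rels P -> word_val (@gval G P) r = 1%g.
Proof.
move=> rP; apply/gval_rel; apply: rst_step.
by have := move_rel (ginv (p := P)) [::] [::] rP; rewrite /= cats0.
Qed.

Lemma cay_path_closed (x : G * seq_sub (rels P)) :
  is_epath cay_org cay_inv x.1 (cay_path x.1 (ssval x.2)) x.1.
Proof.
by have := cay_path_end x.1 (ssval x.2); rewrite rel_val ?mulg1 ?(ssvalP x.2).
Qed.

(* One 2-cell for each g in G and each relator r in R, attached at g along r: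
   the universal cover of the presentation complex of P. *)
Definition cayley : complex2 :=
  @Complex2 G (G * gens P)%type (G * seq_sub (rels P))%type
    cay_org cay_inv fst (fun x => cay_path x.1 (ssval x.2))
    cay_invK cay_inv_neq cay_path_nonnil cay_path_closed.

Definition cay_id : vert cayley := (1%g : G).

Definition cay_lab (d : dart cayley) : gens P := d.2.

End Cayley.

(* The label of the boundary of a 2-cell depends on the starting vertex and
   the direction only up to cyclic conjugation and inversion, under which the
   set of relators is closed. *)
Record vk_diagram (R : realType) (G : groupType) (P : presentation G)
    (w : seq (gens P)) := VkDiagram {
  vk_complex :> complex2;
  vk_base : vert vk_complex;
  vk_lab : dart vk_complex -> gens P;
  vk_emb : realization R vk_complex -> R * R;
  vk_bpath : seq (dart vk_complex);
  vk_finite : finite_complex vk_complex;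
  vk_contractible : contractible R (realization R vk_complex);
  vk_planar : embedding vk_emb;
  vk_lab_inv : forall d, vk_lab (dinv d) = ginv (vk_lab d);
  vk_lab_rel : forall f, map vk_lab (fbd f) \in rels P;
  vk_bpath_closed : epath vk_base vk_bpath vk_base;
  vk_bpath_lab : map vk_lab vk_bpath = w;
  vk_bpath_ccw : reads_boundary_ccw vk_emb vk_base vk_bpath }.

Definition vk_boundary (R : realType) (G : groupType) (P : presentation G)
    (w : seq (gens P)) (D : vk_diagram R w) : set (realization R D) :=
  vk_emb (v := D) @^-1` (closure (~` range (vk_emb (v := D)))).

Definition vk_projection (R : realType) (G : groupType) (P : presentation G)
    (w : seq (gens P)) (D : vk_diagram R w)
    (pr : realization R D -> realization R (cayley P)) : Prop :=
  exists (mv : vert D -> vert (cayley P)) (md : dart D -> dart (cayley P))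
         (mf : face D -> face (cayley P)),
    [/\ mv (vk_base D) = cay_id P,
        (forall d, [/\ org (md d) = mv (org d), md (dinv d) = dinv (md d) &
                       cay_lab (md d) = vk_lab d]),
        (forall f, fbd (mf f) = map md (fbd f)) &
        [/\ forall v, pr (vpt R v) = vpt R (mv v),
            forall d t, pr (ept d t) = ept (md d) t &
            forall f z, pr (fpt f z) = fpt (mf f) z]].

Definition extrinsic_tame_filling (R : realType) (G : groupType)
    (P : presentation G) (f : R -> R) : Prop :=
  quarter_fun f /\
  forall w : seq (gens P), word_val (@gval G P) w = 1%g ->
    exists (D : vk_diagram R w)
           (pr : realization R D -> realization R (cayley P))
           (Psi : realization R D * R -> realization R D),
      [/\ vk_projection pr,
          combing1 (vk_boundary (D := D)) (vpt R (vk_base D)) Psi &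
          tame f (vk_boundary (D := D)) (cay_id P) (pr \o Psi)].

Definition tame_combable (R : realType) (G : groupType) : Prop :=
  exists (P : presentation G)
         (Psi : realization R (cayley P) * R -> realization R (cayley P)),
    combing1 (@skel1 R (cayley P)) (vpt R (cay_id P)) Psi /\
    forall tau, closed_cell01 tau ->
    forall C : set (realization R (cayley P)), compact C ->
    exists D : set (realization R (cayley P)), compact D /\
      let S := (Psi @^-1` D) `&` (tau `*` `[0, 1]) in
      exists2 x, S x &
        (Psi @^-1` C) `&` (tau `*` `[0, 1]) `<=` path_component R S x.

(* Main.v *)
Require Import Defs.
From mathcomp Require Import ring lra zify.

Set Implicit Arguments.
Unset Strict Implicit.
Unset Printing Implicit Defensive.

(** A single diagram gives every vertex and every edge of its boundary a tame path
   back to the base point, but two diagrams disagree about the path of a common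
   vertex, so that the boundary combings do not fit together.  The cure is to
   force the path of each vertex g to be a chosen geodesic.

   For an edge e from g to ga, let w be the word that runs along the geodesic of g,
   through e, and back along the geodesic of ga.  The boundary loop of a filling of
   w, its combing and the projection to the Cayley complex X compose to a square
   F(s,t) in X ([filling_square]): F(s,.) is an f-tame path from the identity to the
   point at parameter s of the loop, and F(0,.) and F(1,.) are constant.  The path of
   the point at parameter u of e is F(u,.), which ends somewhere on the triangle,
   followed by the stretch of the triangle from there to the point u of e ([sweep]).
   For u = 0 this is the geodesic of g, for u = 1 the geodesic of ga, both after a
   pause at the identity; hence the combings of all edges agree at the vertices.
   The last stretch runs along a geodesic in the outward direction, so up to an
   additive constant the coarse distance never drops on it ([tri_pt_tame]), and f
   controls the first stretch ([sweep_tame]).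

   Thus whenever a combing path is at coarse distance at most N at some time, it
   stayed within a bound M(N) before.  A compact set C meets only points of bounded
   coarse distance ([compact_cdist_bounded]), and the points of coarse distance at
   most M lie in a finite, hence compact, union D of closed cells
   ([cdist_ball_compact]).  A point of tau x [0,1] sent to C can then be moved back
   in time to tau x {0} inside the preimage of D, and tau x {0} is connected.

   Everything that is said about points of the realization, which is a quotient,
   rests on one extension principle, [realization_ext]; its weak topology is
   accessed through the criterion [closed_cells] for closed sets. *)

(** * Polar coordinates and functions on the realization *)

Section Circle.
Variable R : realType.
Implicit Types (r s : R) (z : R * R).

Definition circ s : R * R := (cos (2 * pi * s), sin (2 * pi * s)).

Definition rad z : R := Num.sqrt (z.1 ^+ 2 + z.2 ^+ 2).

Lemma sqnorm_circ r s :
  (r * cos (2 * pi * s)) ^+ 2 + (r * sin (2 * pi * s)) ^+ 2 = r ^+ 2 :> R.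
Proof. by rewrite !exprMn -mulrDr cos2Dsin2 mulr1. Qed.

Lemma circ_surj z : z.1 ^+ 2 + z.2 ^+ 2 = 1 ->
  exists2 s, 0 <= s <= 1 & z = circ s.
Proof.
move=> z1; have x1 : -1 <= z.1 <= 1.
  have : z.1 ^+ 2 <= 1 by rewrite -z1 lerDl sqr_ge0.
  by move=> x2; apply/andP; split; nra.
have pi0 := pi_gt0 R.
have ca : cos (acos z.1) = z.1 by apply: acosK; rewrite in_itv.
have sa : sin (acos z.1) = `|z.2|.
  by rewrite sin_acos// -z1 addrC addKr sqrtr_sqr.
have a0 := acos_ge0 x1; have api := acos_lepi x1.
have pis (y : R) : 2 * pi * (y / (2 * pi)) = y.
  by rewrite mulrC divfK// mulf_neq0// gt_eqF.
have bd (y : R) : 0 <= y <= 2 * pi -> 0 <= y / (2 * pi) <= 1.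
  move=> y01; apply/andP; split; first by apply: divr_ge0; lra.
  by rewrite ler_pdivrMr; lra.
case: (lerP 0 z.2) => z20.
- exists (acos z.1 / (2 * pi)); first by apply: bd; lra.
  by rewrite /circ pis ca sa ger0_norm//; case: (z).
- exists ((2 * pi - acos z.1) / (2 * pi)); first by apply: bd; lra.
  rewrite /circ pis [2 * pi - _]addrC mulrC mulr_natr cosD2pi sinD2pi.
  by rewrite cosN sinN ca sa ltr0_norm// opprK; case: (z).
Qed.

Lemma polar_surj z : 1 <= z.1 ^+ 2 + z.2 ^+ 2 -> exists s, 0 <= s <= 1 /\
  z = (rad z * cos (2 * pi * s), rad z * sin (2 * pi * s)).
Proof.
move=> z1; have r0 : 0 < rad z by rewrite sqrtr_gt0; lra.
have rz : rad z ^+ 2 = z.1 ^+ 2 + z.2 ^+ 2 by rewrite sqr_sqrtr//; lra.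
have /(@circ_surj (_, _))[s s01 [e1 e2]] : (z.1 / rad z) ^+ 2 + (z.2 / rad z) ^+ 2 = 1.
  by rewrite !expr_div_n -mulrDl -rz divff// expf_neq0// gt_eqF.
by exists s; split=> //; rewrite -e1 -e2 ![rad z * _]mulrC !divfK ?gt_eqF//;
  case: (z).
Qed.

(** The circle is [0,1] with its ends identified: equal points force the half-angle
   sine of the difference to vanish. *)
Lemma circ_inj s s' : 0 <= s <= 1 -> 0 <= s' <= 1 -> circ s = circ s' ->
  [\/ s = s', s = 0 /\ s' = 1 | s = 1 /\ s' = 0].
Proof.
wlog le : s s' / s <= s'.
  move=> H s01 s'01 e; case: (lerP s s') => [|/ltW] le; first exact: H.
  by case: (H _ _ le s'01 s01 (esym e)) => [->|[-> ->]|[-> ->]];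
    [apply: Or31|apply: Or33|apply: Or32].
move=> s01 s'01 [ec es].
have pi0 := pi_gt0 R.
have c1 : cos (2 * pi * s' - 2 * pi * s) = 1 by rewrite cosB ec es -!expr2 cos2Dsin2.
have s0 : sin (pi * (s' - s)) = 0.
  apply/eqP; rewrite -(sqrf_eq0 (sin _)); apply/eqP.
  have := cos_mulr2n (pi * (s' - s)).
  rewrite (_ : pi * (s' - s) *+ 2 = 2 * pi * s' - 2 * pi * s); last by ring.
  by rewrite c1 cos2sin2; lra.
case: (eqVneq s s') => [->|ne]; first exact: Or31.
case: (eqVneq (s' - s) 1) => [e1|ne1]; first by apply: Or32; lra.
suff : 0 < sin (pi * (s' - s)) by rewrite s0 ltxx.
have lt : s < s' by rewrite lt_neqAle ne.
have lt1 : s' - s < 1 by rewrite lt_neqAle ne1; lra.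
apply: sin_gt0_pi; apply/andP; split; first by apply: mulr_gt0 => //; lra.
by rewrite -[ltRHS]mulr1 ltr_pM2l.
Qed.

Lemma polar_inj r r' s s' : 1 <= r -> 1 <= r' -> 0 <= s <= 1 -> 0 <= s' <= 1 ->
  (r * cos (2 * pi * s), r * sin (2 * pi * s)) =
    (r' * cos (2 * pi * s'), r' * sin (2 * pi * s')) ->
  [\/ s = s', s = 0 /\ s' = 1 | s = 1 /\ s' = 0].
Proof.
move=> r1 r'1 s01 s'01 [e1 e2].
have rr : r = r'.
  apply/eqP; rewrite -(@eqrXn2 _ 2%N) //; try lra.
  by rewrite -(sqnorm_circ r s) e1 e2 sqnorm_circ.
have r0 : r != 0 by rewrite gt_eqF//; lra.
apply: circ_inj => //; rewrite /circ; congr (_, _); apply: (mulfI r0).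
  by rewrite e1 rr.
by rewrite e2 rr.
Qed.

End Circle.

Section Realization.
Variables (R : realType) (K : complex2).
Implicit Types (v : vert K) (d : dart K) (f : face K) (t u : R).

Lemma glue_pi (x y : prept R K) : glue x y ->
  \pi_({eq_quot (@glued_equiv R K)})%qT x =
  \pi_({eq_quot (@glued_equiv R K)})%qT y.
Proof. by move=> g; apply/eqmodP/asboolP; exact: rst_step. Qed.

Lemma ept_org d t : t <= 0 -> ept d t = vpt R (org d).
Proof. by move=> t0; apply: glue_pi; exact: glue_org. Qed.

Lemma ept_inv d t : ept d t = ept (dinv d) (1 - t).
Proof. by apply: glue_pi; exact: glue_inv. Qed.

Lemma ept_tgt d t : 1 <= t -> ept d t = vpt R (tgt d).
Proof. by move=> t1; rewrite ept_inv ept_org// subr_le0. Qed.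

Lemma fpt_bd f r s : 1 <= r -> 0 <= s <= 1 ->
  fpt f (r * cos (2 * pi * s), r * sin (2 * pi * s)) =
  path_pt (R := R) (fbase f) (fbd f) ((size (fbd f))%:R * s).
Proof. by move=> r1 s01; apply: glue_pi; exact: glue_bd. Qed.

(** Every point lies in an open cell, because the closed disc of a 2-cell is the open
   disc together with the points glued to the attaching path. *)
Lemma realization_ind (Q : realization R K -> Prop) :
  (forall v, Q (vpt R v)) -> (forall d t, 0 < t < 1 -> Q (ept d t)) ->
  (forall f (z : R * R), z.1 ^+ 2 + z.2 ^+ 2 < 1 -> Q (fpt f z)) -> forall x, Q x.
Proof.
move=> Qv Qe Qf; have Qe' d t : Q (ept d t).
  case: (ltP 0 t) => t0; last by rewrite ept_org.
  by case: (ltP t 1) => t1; [apply: Qe; rewrite t0|rewrite ept_tgt].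
have Qp p : forall v u, Q (path_pt v p u).
  elim: p => [|d p IH] v u; rewrite /path_pt /=; first exact: Qv.
  by case: ifP => _; [exact: Qe'|exact: IH].
elim/quotW => -[v|d t|f z]; [exact: Qv|exact: Qe'|].
case: (ltP (z.1 ^+ 2 + z.2 ^+ 2) 1) => z1; first exact: Qf.
have [s [s01 ez]] := polar_surj z1.
have -> : \pi_({eq_quot (@glued_equiv R K)})%qT (PF f z) = fpt f z by [].
rewrite ez fpt_bd //.
by rewrite /rad -sqrtr1 ler_wsqrtr.
Qed.

Section Extend.
Variables (T : Type) (hv : vert K -> T) (he : dart K -> R -> T)
  (hf : face K -> R * R -> T).
Hypothesis he_org : forall d t, t <= 0 -> he d t = hv (org d).
Hypothesis he_inv : forall d t, he d t = he (dinv d) (1 - t).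

Let h0 (x : prept R K) : T :=
  match x with PV v => hv v | PE d t => he d t | PF f z => hf f z end.

Let angle (z : R * R) : R := xget 0 [set s | 0 <= s <= 1 /\
  z = (rad z * cos (2 * pi * s), rad z * sin (2 * pi * s))].

Let h (x : prept R K) : T :=
  if x is PF f z then
    if z.1 ^+ 2 + z.2 ^+ 2 < 1 then hf f z
    else h0 (path_pre (fbase f) (fbd f) ((size (fbd f))%:R * angle z))
  else h0 x.

Let h0_start p v w : epath v p w -> h0 (path_pre v p 0) = hv v.
Proof. by case: p => [|d p] //= [<- _]; rewrite ler01 /= he_org. Qed.

Let h0_end p v w : epath v p w -> h0 (path_pre v p (size p)%:R) = hv w.
Proof.
elim: p v => [|d p IH] v /=; first by move=> ->.
case=> _; case: p IH => [|d' p] IH ep.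
  by rewrite lexx /= he_inv subrr he_org//; move: ep => /= ->.
rewrite -(IH _ ep) [size _]/= leNgt ltr1n mulrSr addrK.
by [].
Qed.

Let h_glue x y : glue x y -> h x = h y.
Proof.
case=> [d t t0|d t|f r s r1 s01] /=; [exact: he_org|exact: he_inv|].
rewrite sqnorm_circ ltNge exprn_ege1//=.
set q := (r * _, r * _).
have q1 : 1 <= q.1 ^+ 2 + q.2 ^+ 2 by rewrite sqnorm_circ exprn_ege1.
have rq : 1 <= rad q by rewrite -sqrtr1 ler_wsqrtr.
have [a01 ea] : [set s | 0 <= s <= 1 /\
    q = (rad q * cos (2 * pi * s), rad q * sin (2 * pi * s))] (angle q).
  by have [s' hs'] := polar_surj q1; exact: (xgetI 0 hs').
have -> : h (path_pre (fbase f) (fbd f) ((size (fbd f))%:R * s)) =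
          h0 (path_pre (fbase f) (fbd f) ((size (fbd f))%:R * s)).
  elim: (fbd f) (fbase f) (_ * s) => //= d p IH v u.
  by case: ifP.
have cl := @fbd_closed K f.
case: (polar_inj rq r1 a01 s01 (esym ea)) => [->//|[-> ->]|[-> ->]].
  by rewrite mulr0 mulr1 (h0_start cl) (h0_end cl).
by rewrite mulr0 mulr1 (h0_start cl) (h0_end cl).
Qed.

(** Only the gluing of vertices and edges constrains a function on the realization.
   On the boundary of a 2-cell its value is forced; it is read off at a chosen angle,
   and the two angles 0 and 2 pi of the same boundary point give the same value
   because the attaching path is closed.  Maps into Prop turn this into a tool
   to separate points and to define subsets. *)
Lemma realization_ext : exists H : realization R K -> T,
  [/\ forall v, H (vpt R v) = hv v, forall d t, H (ept d t) = he d t &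
      forall f (z : R * R), z.1 ^+ 2 + z.2 ^+ 2 < 1 -> H (fpt f z) = hf f z].
Proof.
have h_closure x y : clos_refl_sym_trans _ (@glue R K) x y -> h x = h y.
  by elim=> [? ? /h_glue //|//|? ? _ -> //|? ? ? _ -> _ -> //].
have h_pi x : h (repr (\pi_({eq_quot (@glued_equiv R K)})%qT x)) = h x.
  have /eqmodP/asboolP := reprK (\pi_({eq_quot (@glued_equiv R K)})%qT x).
  exact: h_closure.
exists (fun x => h (repr (x : {eq_quot (@glued_equiv R K)}%qT))).
by split=> [v|d t|f z z1]; rewrite h_pi//= z1.
Qed.

End Extend.
End Realization.

(** * The weak topology *)

Lemma closed_preimage (S T : topologicalType) (f : S -> T) (C : set T) :
  continuous f -> closed C -> closed (f @^-1` C).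
Proof. by move/continuous_closedP; apply. Qed.

Lemma continuous_pairing (S T U : topologicalType) (f : S -> T) (g : S -> U) :
  continuous f -> continuous g -> continuous (fun x => (f x, g x)).
Proof. by move=> cf cg x; exact: (cvg_pair (cf x) (cg x)). Qed.

Lemma continuous_after (S T U : topologicalType) (g : T -> U) (f : S -> T) :
  continuous g -> continuous f -> continuous (fun x => g (f x)).
Proof. by move=> cg cf x; apply: (@continuous_comp _ _ _ f g); [exact: cf|exact: cg]. Qed.

Lemma continuous_proj1 (S T : topologicalType) : continuous (@fst S T).
Proof. by move=> x; exact: cvg_fst. Qed.

Lemma continuous_proj2 (S T : topologicalType) : continuous (@snd S T).
Proof. by move=> x; exact: cvg_snd. Qed.

Section RealValued.
Variables (R : realType) (S : topologicalType) (f g : S -> R).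
Hypotheses (cf : continuous f) (cg : continuous g).

Lemma continuous_add : continuous (fun x => f x + g x).
Proof. by move=> x; apply: (@cvgD _ R^o); [exact: cf|exact: cg]. Qed.

Lemma continuous_opp : continuous (fun x => - f x).
Proof. by move=> x; apply: (@cvgN _ R^o); exact: cf. Qed.

Lemma continuous_mul : continuous (fun x => f x * g x).
Proof. by move=> x; apply: cvgM; [exact: cf|exact: cg]. Qed.

Lemma continuous_maxr : continuous (fun x => Num.max (f x) (g x)).
Proof. by move=> x; apply: continuous_max; [exact: cf|exact: cg]. Qed.

Lemma continuous_minr : continuous (fun x => Num.min (f x) (g x)).
Proof. by move=> x; apply: continuous_min; [exact: cf|exact: cg]. Qed.

End RealValued.

Lemma continuous_cst (S T : topologicalType) (a : T) :
  continuous (fun _ : S => a).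
Proof. by move=> x; exact: cvg_cst. Qed.

Section Topology.
Variables (R : realType) (K : complex2).
Implicit Types (v : vert K) (d : dart K) (f : face K) (t u : R)
  (C : set (realization R K)).

Lemma ept_continuous d : continuous (@ept R K d).
Proof. by apply/continuousP => U [Ue _]; exact: Ue. Qed.

Lemma fpt_continuous f : continuous (@fpt R K f).
Proof. by apply/continuousP => U [_ Uf]; exact: Uf. Qed.

Lemma path_pt_cons v d p u : path_pt v (d :: p) u =
  if u <= 1 then ept d u else path_pt (tgt d) p (u - 1).
Proof. by rewrite /path_pt /=; case: ifP. Qed.

Lemma path_pt_le0 v p w u : epath v p w -> u <= 0 -> path_pt v p u = vpt R v.
Proof.
case: p => [|d p] //= [<- _] u0; rewrite path_pt_cons.
by rewrite (le_trans u0) ?ept_org.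
Qed.

Lemma path_pt_cons_ge1 v d p w u : epath v (d :: p) w -> 1 <= u ->
  path_pt v (d :: p) u = path_pt (tgt d) p (u - 1).
Proof.
move=> [_ ep] u1; rewrite path_pt_cons; case: leP => // u1'.
by rewrite ept_tgt// (path_pt_le0 ep)// subr_le0.
Qed.

Lemma path_pt_ge v p w u : epath v p w -> (size p)%:R <= u ->
  path_pt v p u = vpt R w.
Proof.
elim: p v u => [|d p IH] v u; first by move=> /= ->.
move=> ep; rewrite [size _]/= mulrSr => u1.
rewrite (path_pt_cons_ge1 ep); first by apply: IH; [case: ep|lra].
by have := ler0n R (size p); lra.
Qed.

Lemma closed_path_pt C v p w : (forall d, closed (@ept R K d @^-1` C)) ->
  epath v p w -> closed (@path_pt R K v p @^-1` C).
Proof.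
move=> Ce; elim: p v => [|d p IH] v ep.
  have [Cv|Cv] := pselect (C (vpt R v)).
    suff -> : @path_pt R K v [::] @^-1` C = setT by exact: closedT.
    by apply/seteqP; split=> u.
  suff -> : @path_pt R K v [::] @^-1` C = set0 by exact: closed0.
  by apply/seteqP; split=> u // /Cv.
have -> : @path_pt R K v (d :: p) @^-1` C =
    ([set u | u <= 1] `&` @ept R K d @^-1` C) `|`
    ([set u | 1 <= u] `&` (fun u => u - 1) @^-1` (@path_pt R K (tgt d) p @^-1` C)).
  apply/seteqP; split=> u /=.
    move=> Cu; case: (leP u 1) => [u1|/ltW u1].
      by left; move: Cu; rewrite path_pt_cons u1.
    by right; move: Cu; rewrite (path_pt_cons_ge1 ep).
  case=> -[u1]; first by rewrite path_pt_cons u1.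
  by rewrite (path_pt_cons_ge1 ep).
apply: closedU; first by apply: closedI => //; exact: closed_le.
apply: closedI; first exact: closed_ge.
apply: closed_preimage; last by apply: IH; case: ep.
by move=> x; apply: continuousB; [exact: cvg_id|exact: cvg_cst].
Qed.

Lemma path_pt_continuous v p w : epath v p w -> continuous (@path_pt R K v p).
Proof.
move=> ep; apply/continuous_closedP => C cC; apply: closed_path_pt ep => d.
by apply: closed_preimage => //; exact: ept_continuous.
Qed.

Lemma path_pt_cat v p1 x p2 w u : epath v p1 x -> epath x p2 w ->
  path_pt v (p1 ++ p2) u =
  if u <= (size p1)%:R then path_pt v p1 u else path_pt x p2 (u - (size p1)%:R).
Proof.
elim: p1 v u => [|d p1 IH] v u ep1 ep2.
  move: ep1 => /= ->; rewrite subr0; case: leP => // u0.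
  by rewrite (path_pt_le0 ep2).
rewrite cat_cons !path_pt_cons [size _]/= mulrSr; have [_ ep1'] := ep1.
have n0 := ler0n R (size p1).
rewrite (IH _ _ ep1' ep2) lerBlDr; case: (leP u 1) => u1.
  by case: leP => // u2; exfalso; lra.
by rewrite opprD addrA addrAC.
Qed.

Lemma epath_cat v p1 x p2 w : epath v p1 x -> epath x p2 w ->
  epath v (p1 ++ p2) w.
Proof. by elim: p1 v => [|d p1 IH] v /=; [move->|case=> <- /IH h /h]. Qed.

Lemma epath_rev v p w : epath v p w -> epath w (rev (map (@dinv K) p)) v.
Proof.
elim: p v => [|d p IH] v /=; first by move=> ->.
case=> <- /IH h; rewrite rev_cons -cats1; apply: epath_cat h _.
by split=> //=; rewrite dinvK.
Qed.

Lemma path_pt_rev v p w u : epath v p w -> 0 <= u <= (size p)%:R ->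
  path_pt w (rev (map (@dinv K) p)) u = path_pt v p ((size p)%:R - u).
Proof.
elim: p v => [|d p IH] v; first by move=> /= ->.
move=> ep; rewrite [size _]/= mulrSr => u01.
have [eo ep'] := ep; rewrite map_cons rev_cons -cats1.
have ed : epath (tgt d) [:: dinv d] v by split=> //=; rewrite dinvK.
rewrite (path_pt_cat _ (epath_rev ep') ed) size_rev size_map.
case: leP => u1.
  rewrite (IH _ ep') ?(path_pt_cons_ge1 ep) ?u1 ?andbT; [congr path_pt|..]; lra.
rewrite !path_pt_cons; case: leP => h1; case: leP => h2; try by exfalso; lra.
by rewrite ept_inv dinvK; congr ept; lra.
Qed.

(** The set of parameters of the attaching path that land in C is compact, so its
   image on the circle is closed, and the rim is the preimage of that image under
   the radial projection. *)
Lemma closed_rim C f : (forall d, closed (@ept R K d @^-1` C)) ->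
  closed [set z : R * R | 1 <= z.1 ^+ 2 + z.2 ^+ 2 /\ C (fpt f z)].
Proof.
move=> Ce.
pose S := `[0, 1] `&`
  (fun s => (size (fbd f))%:R * s) @^-1` (@path_pt R K (fbase f) (fbd f) @^-1` C).
have cS : compact S.
  apply: (subclosed_compact _ (@segment_compact R 0 1)); last by move=> s [].
  apply: closedI; first exact: itv_closed.
  apply: closed_preimage; last exact: (closed_path_pt Ce (@fbd_closed K f)).
  exact: mulrl_continuous.
have ccirc : continuous (@circ R).
  apply: continuous_pairing; apply: continuous_after;
    [exact: continuous_cos|exact: mulrl_continuous|exact: continuous_sin|
     exact: mulrl_continuous].
have cC : closed (@circ R @` S).
  apply: compact_closed; first exact: norm_hausdorff.
  by apply: continuous_compact => //; exact: continuous_subspaceT.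
have csq : continuous (fun z : R * R => z.1 ^+ 2 + z.2 ^+ 2).
  by apply: continuous_add; apply: continuous_mul;
    (exact: continuous_proj1 || exact: continuous_proj2).
(* Dividing by max 1 |z| instead of |z| gives a projection continuous at 0. *)
pose m z : R := Num.max 1 (rad z).
have m1 z : 1 <= m z by rewrite le_max lexx.
have cm : continuous m.
  apply: continuous_maxr; first exact: continuous_cst.
  apply: continuous_after csq; exact: sqrt_continuous.
pose n z : R * R := (z.1 / m z, z.2 / m z).
have cn : continuous n.
  have cV : continuous (fun z => (m z)^-1).
    by move=> z; apply: continuousV; [rewrite gt_eqF// (lt_le_trans _ (m1 z))|exact: cm].
  by apply: continuous_pairing; apply: continuous_mul => //;
    (exact: continuous_proj1 || exact: continuous_proj2).
suff -> : [set z : R * R | 1 <= z.1 ^+ 2 + z.2 ^+ 2 /\ C (fpt f z)] =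
    (fun z : R * R => z.1 ^+ 2 + z.2 ^+ 2) @^-1` [set x | 1 <= x] `&`
    n @^-1` (@circ R @` S).
  by apply: closedI; apply: closed_preimage => //; exact: closed_ge.
apply/seteqP; split=> z /= [z1 h]; split=> //.
all: have rz : 1 <= rad z by rewrite /rad -sqrtr1 ler_wsqrtr.
all: have mz : m z = rad z by rewrite /m; apply/max_idPr.
all: have r0 : rad z != 0 by rewrite gt_eqF//; lra.
  have [s [s01 ez]] := polar_surj z1; exists s; last first.
    have e1 : z.1 = rad z * cos (2 * pi * s) by rewrite {1}ez.
    have e2 : z.2 = rad z * sin (2 * pi * s) by rewrite {1}ez.
    by rewrite /n mz; congr (_, _); apply: (canRL (mulfK r0)); rewrite mulrC.
  split; first by rewrite /= in_itv.
  by move: h; rewrite ez fpt_bd.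
case: h => s [/= s01 Cs] [e1 e2].
have -> : z = (rad z * cos (2 * pi * s), rad z * sin (2 * pi * s)).
  by rewrite e1 e2 mz ![rad z * _]mulrC !divfK//; case: (z).
by move: s01; rewrite in_itv/= => s01; rewrite fpt_bd.
Qed.

(** Closedness only has to be tested on edges for a set that contains each 2-cell
   entirely or misses its interior: on the boundary of a 2-cell, [closed_rim]
   follows from the edges. *)
Lemma closed_cells C : (forall d, closed (@ept R K d @^-1` C)) ->
  (forall f, (forall z, C (fpt f z)) \/
     (forall z : R * R, z.1 ^+ 2 + z.2 ^+ 2 < 1 -> ~ C (fpt f z))) -> closed C.
Proof.
move=> Ce Cf; rewrite -[C]setCK; apply: open_closedC.
suff : cw_open (~` C) by [].
split=> [d|f].
  by rewrite preimage_setC; apply: closed_openC; exact: Ce.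
rewrite preimage_setC; apply: closed_openC.
case: (Cf f) => Cz.
  apply: (eq_ind setT) closedT _ _.
  by apply/seteqP; split=> z.
apply: (eq_ind _ _ (closed_rim (f := f) Ce)); apply/seteqP; split=> z /=.
  by case.
by move=> Cfz; split=> //; rewrite leNgt; apply/negP => /Cz.
Qed.

Lemma fpt_notin_skel1 f (z : R * R) : z.1 ^+ 2 + z.2 ^+ 2 < 1 ->
  ~ skel1 (fpt f z).
Proof.
move=> z1; have [H [Hv He Hf]] := realization_ext (R := R) (K := K)
  (hv := fun=> False) (he := fun _ _ => False) (fun _ _ => True)
  (fun _ _ _ => erefl) (fun _ _ => erefl).
by case=> [[v e]|[d [t e]]]; have := Hf f z z1; rewrite e ?Hv ?He => ->.
Qed.

(** The product with [0,1] does not commute with quotient topologies in general; it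
   does here because neighbourhoods in [0,1] can be taken compact.  Over such a
   neighbourhood J, the tube lemma shows that the points of the 1-skeleton whose
   fibre over J leaves a given open set form a closed set. *)
Lemma skel1_cylinder_continuous (Y : topologicalType)
    (Psi : realization R K * R -> Y) :
  (forall v, continuous (fun t => Psi (vpt R v, t))) ->
  (forall d, continuous (fun z : R * R => Psi (ept d z.1, z.2))) ->
  {within @skel1 R K `*` `[0, 1], continuous Psi}.
Proof.
move=> Pv Pe; apply/subspace_continuousP => -[x t0] [/= sx _] W.
rewrite /= => /nbhs_interior W0.
have ct : continuous (fun t => Psi (x, t)).
  case: sx => [[v ->]|[d [u ->]]]; first exact: Pv.
  apply: (continuous_after (f := fun t => (u, t)) (Pe d)).
  by apply: continuous_pairing; [exact: continuous_cst|move=> t; exact: cvg_id].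
have [e /= e0 He] : exists2 e : R, 0 < e & forall t, `|t0 - t| <= e -> (W°) (Psi (x, t)).
  have /nbhs_ballP[e /= e0 He] := ct t0 _ W0.
  exists (e / 2); first by rewrite divr_gt0.
  by move=> t te; apply: He; rewrite /ball/=; lra.
pose J := `[t0 - e, t0 + e]%classic.
pose C := [set y | skel1 y /\ exists2 t, J t & ~ (W°) (Psi (y, t))].
have cC : closed C.
  apply: closed_cells => [d|f]; last first.
    by right=> z /fpt_notin_skel1 z1 [/z1].
  have -> : ept d @^-1` C = ~` [set u : R | J `<=` [set t | (W°) (Psi (ept d u, t))]].
    apply/seteqP; split=> u /=.
      by move=> [_ [t Jt nW]] /(_ t Jt).
    move=> h; split; first by right; exists d, u.
    by apply: contrapT => nex; apply: h => t Jt /=; apply: contrapT => nW; apply: nex; exists t.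
  apply: open_closedC; rewrite openE => u Ju.
  have /compact_near_coveringP := @segment_compact R (t0 - e) (t0 + e).
  move=> /(_ R (nbhs u) (fun u t => (W°) (Psi (ept d u, t))) _); apply.
  move=> t Jt; have := Pe d (u, t) (W°).
  rewrite /= => /(_ _)[]; first by apply: open_nbhs_nbhs; split; [exact: open_interior|exact: Ju].
  case=> [A B] /= [Au Bt] AB; exists (B, A) => //= -[b a] /= [Bb Aa]; exact: (AB (a, b)).
exists ((~` C), [set t | `|t0 - t| < e]) => /=.
  split; last by apply/nbhs_ballP; exists e.
  apply: open_nbhs_nbhs; split; first exact: closed_openC.
  move=> [_ [t Jt]]; apply; apply: He; move: Jt; rewrite /J/= in_itv/=.
  by rewrite ler_distlC.
move=> [y t] /= [nC te] [/= sy _]; apply: interior_subset; apply: contrapT => nW.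
apply: nC; split=> //; exists t => //; rewrite /J/= in_itv/=.
by rewrite -ler_distlC ltW.
Qed.

End Topology.

(** * Word length and coarse distance in the Cayley complex *)

Section WordLength.
Variables (G : groupType) (P : presentation G).
Implicit Types (g h : G) (a : gens P) (w : seq (gens P)).

Definition wval w : G := word_val (@gval G P) w.

Lemma wval_cat w1 w2 : wval (w1 ++ w2) = (wval w1 * wval w2)%g.
Proof. by elim: w1 => [|a w1 IH] /=; rewrite ?mul1g// IH mulgA. Qed.

Lemma wval_inv w : wval (inv_word (@ginv G P) w) = ((wval w)^-1)%g.
Proof.
elim: w => [|a w IH]; first by rewrite invg1.
rewrite /inv_word map_cons rev_cons -cats1 wval_cat IH /=.
by rewrite mulg1 gval_inv invgM.
Qed.

Lemma size_inv_word w : size (inv_word (@ginv G P) w) = size w.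
Proof. by rewrite size_rev size_map. Qed.

Lemma geod_ex g : exists w, wval w = g /\
  forall w', wval w' = g -> (size w <= size w')%N.
Proof.
have ex : exists n, `[< exists2 w, wval w = g & size w = n >].
  by have [w ew] := gval_gen P g; exists (size w); apply/asboolP; exists w.
case: (ex_minnP ex) => n /asboolP[w ew <-] nmin.
exists w; split=> // w' ew'; apply: nmin.
by apply/asboolP; exists w'.
Qed.

Definition geod g : seq (gens P) := projT1 (cid (geod_ex g)).

Definition wlen g : nat := size (geod g).

Lemma geodK g : wval (geod g) = g.
Proof. by rewrite /geod; case: cid => w []. Qed.

Lemma wlen_min w : (wlen (wval w) <= size w)%N.
Proof. by rewrite /wlen /geod; case: cid => w' [_ h] /=; exact: h. Qed.

Lemma wlen_mul g w : (wlen (g * wval w)%g <= wlen g + size w)%N.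
Proof. by rewrite -{1}(geodK g) -wval_cat -size_cat wlen_min. Qed.

Lemma wlen1 : wlen 1%g = 0%N.
Proof. by have := wlen_min [::]; rewrite leqn0 => /eqP. Qed.

Lemma geod1 : geod 1%g = [::].
Proof. by apply/size0nil; exact: wlen1. Qed.

Lemma wlen_edge (d : dart (cayley P)) :
  (wlen (org d) <= (wlen (tgt d)).+1)%N /\ (wlen (tgt d) <= (wlen (org d)).+1)%N.
Proof.
case: d => g a; rewrite /tgt /=.
have := wlen_mul (g * gval a)%g [:: ginv a]; have := wlen_mul g [:: a].
by rewrite /= /wval /= !mulg1 gval_inv mulgK !addn1; split.
Qed.

Definition triangle g a : seq (gens P) :=
  geod g ++ a :: inv_word (@ginv G P) (geod (g * gval a)%g).

Lemma size_triangle g a :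
  size (triangle g a) = (wlen g + 1 + wlen (g * gval a)%g)%N.
Proof. by rewrite size_cat /= size_inv_word addnS addn1 addSn. Qed.

Lemma triangle_val g a : wval (triangle g a) = 1%g.
Proof.
rewrite wval_cat /= -/(wval _) wval_inv !geodK mulgA.
exact: mulgV.
Qed.

Lemma wlen_take_geod g k : (k <= wlen g)%N ->
  wlen (wval (take k (geod g))) = k.
Proof.
move=> kn; apply/eqP; rewrite eqn_leq; apply/andP; split.
  by apply: leq_trans (wlen_min _) _; rewrite size_take_min geq_minl.
have := wlen_mul (wval (take k (geod g))) (drop k (geod g)).
rewrite -wval_cat cat_take_drop geodK size_drop -/(wlen g); lia.
Qed.

(** The upper bound counts letters from either end of the loop; the lower bound is that
   both sides of the triangle are geodesic. *)
Lemma wlen_take_triangle g a k : (k <= size (triangle g a))%N ->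
  wlen (wval (take k (triangle g a))) = minn k (size (triangle g a) - k).
Proof.
set w := triangle g a => kL.
have kl : (wlen (wval (take k w)) <= k)%N.
  by apply: leq_trans (wlen_min _) _; rewrite size_take_min geq_minl.
have kr : (wlen (wval (take k w)) <= size w - k)%N.
  have -> : wval (take k w) = wval (inv_word (@ginv G P) (drop k w)).
    apply: (mulIg (wval (drop k w))).
    by rewrite wval_inv mulVg -wval_cat cat_take_drop triangle_val.
  by apply: leq_trans (wlen_min _) _; rewrite size_inv_word size_drop.
have := size_triangle g a; rewrite -/w => sw.
have [d1 d2] := wlen_edge (g, a); rewrite /tgt /= in d1 d2.
have tn : take (wlen g) w = geod g by rewrite /w /triangle take_size_cat.
case: (leqP k (wlen g)) => kn.
  have := wlen_take_geod kn.
  by rewrite -{1}tn take_takel// => ->; rewrite /minn; case: ifP; lia.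
have tn1 : wval (take (wlen g).+1 w) = (g * gval a)%g.
  rewrite /w /triangle -cat_rcons take_size_cat; last by rewrite size_rcons.
  by rewrite -cats1 wval_cat geodK /= /wval /= mulg1.
have := wlen_mul (wval (take k w)) (inv_word (@ginv G P) (drop (wlen g).+1 (take k w))).
rewrite wval_inv -{1}(cat_take_drop (wlen g).+1 (take k w)) wval_cat mulgK.
rewrite take_takel// tn1 size_inv_word size_drop size_takel//.
by rewrite /minn; case: ifP; lia.
Qed.

Lemma cay_path_cat g w1 w2 :
  cay_path g (w1 ++ w2) = cay_path g w1 ++ cay_path (g * wval w1)%g w2.
Proof.
elim: w1 g => [|a w1 IH] g /=; first by rewrite mulg1.
by rewrite IH mulgA.
Qed.

Lemma cay_path_inv g w : cay_path (g * wval w)%g (inv_word (@ginv G P) w) =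
  rev (map (@dinv (cayley P)) (cay_path g w)).
Proof.
elim: w g => [|a w IH] g //=.
rewrite /inv_word map_cons !rev_cons -!cats1 -/(inv_word _ _) cay_path_cat.
rewrite mulgA IH wval_inv /=; congr (_ ++ [:: (_, _)]).
by rewrite mulgK.
Qed.

Lemma size_cay_path g w : size (cay_path g w) = size w.
Proof. by elim: w g => //= a w IH g; rewrite IH. Qed.

Lemma cay_epath g w : epath (K := cayley P) g (cay_path g w) (g * wval w)%g.
Proof. exact: cay_path_end. Qed.

Lemma epath_cay (p : seq (dart (cayley P))) g h :
  epath (K := cayley P) g p h ->
  p = cay_path g (map (@cay_lab G P) p) /\
  h = (g * wval (map (@cay_lab G P) p))%g.
Proof.
elim: p g => [|[g' a] p IH] g /=; first by move=> ->; rewrite mulg1.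
case=> /= <- /IH[ep eh]; rewrite /cay_lab /=; split.
  by congr cons; exact: ep.
by rewrite eh -mulgA.
Qed.

Variable R : realType.

Lemma edge_distE g : edge_dist R (K := cayley P) (cay_id P) g = (wlen g)%:R.
Proof.
apply/eqP; rewrite eq_le; apply/andP; split.
  apply: ge_inf.
    by exists 0 => x [p _ <-]; exact: ler0n.
  exists (cay_path (cay_id P) (geod g)); last by rewrite size_cay_path.
  by have := cay_epath (cay_id P) (geod g); rewrite geodK mul1g.
apply: lb_le_inf.
  exists (wlen g)%:R, (cay_path (cay_id P) (geod g)); last by rewrite size_cay_path.
  by have := cay_epath (cay_id P) (geod g); rewrite geodK mul1g.
move=> x [p /= /epath_cay[_ ->] <-]; rewrite ler_nat mul1g.
by apply: leq_trans (wlen_min _) _; rewrite size_map.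
Qed.

Local Notation X := (realization R (cayley P)).

Definition edge_height (d : dart (cayley P)) : R :=
  Num.min (wlen (org d))%:R (wlen (tgt d))%:R + 1 / 2.

Lemma coarse_edgeE d : coarse_edge R (cay_id P) d = edge_height d.
Proof. by rewrite /coarse_edge !edge_distE. Qed.

Lemma cdist_ex : exists H : X -> R,
  [/\ forall g, H (vpt R (g : vert (cayley P))) = (wlen g)%:R,
      forall d t, H (ept d t) = if t <= 0 then (wlen (org d))%:R else
        if 1 <= t then (wlen (tgt d))%:R else edge_height d &
      forall f (z : R * R), z.1 ^+ 2 + z.2 ^+ 2 < 1 ->
        H (fpt f z) = \big[Num.max/0]_(d <- fbd f) edge_height d - 1 / 4].
Proof.
apply: realization_ext => [d t ->//|d t].
have -> : edge_height (dinv d) = edge_height d.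
  by rewrite /edge_height /tgt dinvK minC.
rewrite /tgt dinvK; case: (leP t 0) => t0; case: (leP 1 t) => t1;
  case: (leP (1 - t) 0) => t2; case: (leP 1 (1 - t)) => t3 //; exfalso; lra.
Qed.

(** The coarse distance is given as an inductive relation on points; that it is the
   graph of a function is proved by [coarse_cdist] and [cdist_coarse]. *)
Definition cdist : X -> R := projT1 (cid cdist_ex).

Lemma cdist_vpt g : cdist (vpt R (g : vert (cayley P))) = (wlen g)%:R.
Proof. by rewrite /cdist; case: cid => H []. Qed.

Lemma cdist_ept d t : 0 < t < 1 -> cdist (ept d t) = edge_height d.
Proof.
move=> /andP[t0 t1]; rewrite /cdist; case: cid => H [_ h _] /=.
by rewrite h !leNgt t0 t1.
Qed.

Lemma cdist_fpt f (z : R * R) : z.1 ^+ 2 + z.2 ^+ 2 < 1 ->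
  cdist (fpt f z) = \big[Num.max/0]_(d <- fbd f) edge_height d - 1 / 4.
Proof. by rewrite /cdist; case: cid => H [_ _ h] /=; exact: h. Qed.

Lemma coarse_cdist x q : coarse (cay_id P) x q -> q = cdist x.
Proof.
case=> [g|d t t01|f z z1]; first by rewrite cdist_vpt edge_distE.
  by rewrite cdist_ept// coarse_edgeE.
by rewrite cdist_fpt//; congr (_ - _); apply: eq_bigr => d _; rewrite coarse_edgeE.
Qed.

Lemma cdist_coarse x : coarse (cay_id P) x (cdist x).
Proof.
elim/realization_ind: x => [g|d t t01|f z z1].
- by rewrite cdist_vpt -edge_distE; constructor.
- by rewrite cdist_ept// -coarse_edgeE; constructor.
- rewrite cdist_fpt//.
  under eq_bigr => d _ do rewrite -coarse_edgeE.
  by constructor.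
Qed.

Lemma edge_height_near d :
  `|edge_height d - (wlen (org d))%:R| <= 1 /\
  `|edge_height d - (wlen (tgt d))%:R| <= 1.
Proof.
have [d1 d2] := wlen_edge d.
have {d1} : ((wlen (org d))%:R : R) <= (wlen (tgt d))%:R + 1.
  by rewrite -(natrD _ _ 1) addn1 ler_nat.
have {d2} : ((wlen (tgt d))%:R : R) <= (wlen (org d))%:R + 1.
  by rewrite -(natrD _ _ 1) addn1 ler_nat.
rewrite /edge_height !ler_norml.
case: (lerP (wlen (org d))%:R ((wlen (tgt d))%:R : R)) => h.
  by move=> h1 h2; split; apply/andP; split; lra.
by move=> h1 h2; split; apply/andP; split; lra.
Qed.

Lemma cdist_ept_near d t : `|cdist (ept d t) - (wlen (org d))%:R| <= 1.
Proof.
have [d1 d2] := wlen_edge d.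
case: (lerP t 0) => t0; first by rewrite ept_org// cdist_vpt subrr normr0.
case: (lerP 1 t) => t1; last by rewrite cdist_ept ?t0//; case: (edge_height_near d).
rewrite ept_tgt// cdist_vpt ler_distl.
by rewrite lerBlDr !natr1 !ler_nat d1 d2.
Qed.

Lemma quarters_nat n : @quarters R n%:R.
Proof. by exists (4 * n)%N; rewrite natrM mulrC mulKf// pnatr_eq0. Qed.

Lemma edge_height_half d : exists n, edge_height d = n%:R + 1 / 2.
Proof.
by rewrite /edge_height; case: leP => _; eexists.
Qed.

Lemma cdist_quarters x : quarters (cdist x).
Proof.
elim/realization_ind: x => [g|d t t01|f z z1].
- by rewrite cdist_vpt; exact: quarters_nat.
- rewrite cdist_ept//; have [n ->] := edge_height_half d.
  by exists (4 * n + 2)%N; rewrite natrD natrM; lra.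
- rewrite cdist_fpt//.
  have [n ->] : exists n, \big[Num.max/0]_(d <- fbd f) edge_height d =
      n%:R + 1 / 2 :> R.
    have := @fbd_nonnil _ f; elim: (fbd f) => // d p IH _; rewrite big_cons.
    have [n ->] := edge_height_half d; case: p IH => [|d' p] IH.
      by exists n; rewrite big_nil; apply/max_idPl; have := ler0n R n; lra.
    by have [//|m ->] := IH; case: leP => _; eexists.
  by exists (4 * n + 1)%N; rewrite natrD natrM; lra.
Qed.

Lemma cdist_cay_path g w u : 0 <= u <= (size w)%:R -> exists k : nat,
  [/\ (k <= size w)%N, k%:R <= u <= k%:R + 1 &
   `|cdist (path_pt (K := cayley P) g (cay_path g w) u) -
       (wlen (g * wval (take k w))%g)%:R| <= 1].
Proof.
elim: w g u => [|a w IH] g u u01.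
  exists 0%N; split=> //.
    rewrite add0r; move: u01 => /andP[u0 u1]; apply/andP; split=> //.
    exact: le_trans u1 ler01.
  by rewrite /= mulg1 [path_pt _ _ _]/(vpt R _) cdist_vpt subrr normr0.
rewrite [cay_path _ _]/= path_pt_cons; case: (lerP u 1) => u1.
  exists 0%N; split=> //; first by rewrite add0r; case/andP: u01 => ->.
  by rewrite take0 mulg1; exact: (cdist_ept_near (g, a)).
have [|k [kw kb kd]] := IH (g * gval a)%g (u - 1).
  by move: u01; rewrite [size _]/= -natr1; lra.
by exists k.+1; split=> //; [rewrite -natr1; lra|rewrite /= mulgA].
Qed.

Lemma cdist_geod g u : 0 <= u <= (wlen g)%:R ->
  `|cdist (path_pt (K := cayley P) (cay_id P) (cay_path (cay_id P) (geod g)) u) - u| <= 2.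
Proof.
move=> /(@cdist_cay_path (cay_id P))[k [kw kb]].
rewrite mul1g wlen_take_geod// !ler_norml; lra.
Qed.

Lemma cdist_triangle g a (L := (size (triangle g a))%:R : R) u : 0 <= u <= L ->
  `|cdist (path_pt (K := cayley P) (cay_id P)
       (cay_path (cay_id P) (triangle g a)) u) - Num.min u (L - u)| <= 2.
Proof.
move=> /(@cdist_cay_path (cay_id P))[k [kw kb]].
rewrite mul1g wlen_take_triangle// natr_min natrB// -/L !ler_norml.
by case: (leP k%:R (L - k%:R)) => h1; case: (leP u (L - u)) => h2; lra.
Qed.

End WordLength.

(** * Compact sets and the coarse distance *)

Section Compact.
Variables (R : realType) (G : groupType) (P : presentation G).
Local Notation X := (realization R (cayley P)).
Implicit Types (g : G) (a : gens P) (w : seq (gens P)) (d : dart (cayley P)).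

Definition max_rel : nat := \max_(r <- rels P) size r.

Lemma size_rel (f : face (cayley P)) : (size (fbd f) <= max_rel)%N.
Proof.
case: f => g [r rP] /=; rewrite size_cay_path /max_rel.
by rewrite (big_rem r)//= leq_maxl.
Qed.

Lemma edge_height_le d : edge_height R d <= (wlen P (org d))%:R + 1 / 2.
Proof. by rewrite /edge_height lerD2r ge_min lexx. Qed.

Lemma edge_height_ge d : (wlen P (org d))%:R - 1 / 2 <= edge_height R d.
Proof.
have [h _] := wlen_edge d.
rewrite /edge_height -lerBlDr le_min; apply/andP; split; first by lra.
have : (wlen P (org d))%:R <= (wlen P (tgt d))%:R + 1 :> R.
  by rewrite natr1 ler_nat.
by lra.
Qed.

Lemma path_height_le g w : \big[Num.max/0]_(d <- cay_path g w) edge_height R d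
  <= (wlen P g + size w)%:R + 1 / 2.
Proof.
elim: w g => [|a w IH] g.
  by rewrite big_nil; have := ler0n R (wlen P g + size ([::] : seq (gens P))); lra.
rewrite big_cons ge_max; apply/andP; split.
  apply: le_trans (edge_height_le _) _.
  by rewrite lerD2r ler_nat leq_addr.
apply: le_trans (IH _) _; rewrite lerD2r ler_nat.
have [_] := wlen_edge ((g, a) : dart (cayley P)); rewrite /tgt /=; lia.
Qed.

(** The coarse distance jumps between a cell and its boundary, so its sublevel sets need
   not be open.  The complements of these subcomplexes replace them in an open cover
   of the complex.  A 2-cell based further than N + [max_rel] has its whole boundary
   beyond N, so that a removed cell is removed together with its boundary. *)
Lemma far_subcomplex (N : nat) : exists C : set X, [/\ closed C,
  forall g, C (vpt R (g : vert (cayley P))) <-> (N < wlen P g)%N,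
  forall d t, 0 < t < 1 -> C (ept d t) <->
    (N < wlen P (org d) /\ N < wlen P (tgt d))%N &
  forall f (z : R * R), z.1 ^+ 2 + z.2 ^+ 2 < 1 ->
    C (fpt f z) <-> (N + max_rel < wlen P (fbase f))%N].
Proof.
have [d t t0|d t|H [Hv He Hf]] := @realization_ext R (cayley P) Prop
  (fun g => (N < wlen P g)%N : Prop)
  (fun d t => (t < 1 -> (N < wlen P (org d))%N) /\
              (0 < t -> (N < wlen P (tgt d))%N))
  (fun f _ => (N + max_rel < wlen P (fbase f))%N : Prop).
- apply/propext; split=> [[h _]|h]; first by apply: h; lra.
  by split=> // t1; lra.
- by apply/propext; rewrite /tgt dinvK; split=> -[h1 h2]; split=> h;
    (apply: h1 || apply: h2); lra.
exists H; split; last by move=> f z z1; rewrite Hf.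
- apply: closed_cells => [d|f].
    have hc (b : bool) (A : set R) : closed A -> closed [set t | A t \/ b].
      by case: b => cA; [apply: (eq_ind setT) closedT _ _|apply: (eq_ind A) cA _ _];
        apply/seteqP; split=> t //=; [right|left|case].
    have cA := closedI (hc (N < wlen P (org d))%N _ (@closed_ge R 1))
                    (hc (N < wlen P (tgt d))%N _ (@closed_le R 0)).
    apply: (eq_ind _ (fun A : set R => closed A) cA); apply/seteqP; split=> t /=; rewrite He.
      by move=> [[h1|h1] [h2|h2]]; split=> // h; exfalso; lra.
    move=> [h1 h2]; split.
      by case: (leP 1 t) => [|/h1]; [left|right].
    by case: (leP t 0) => [|/h2]; [left|right].
  case: (boolP (N + max_rel < wlen P (fbase f))%N) => hf; last first.
    by right=> z z1; rewrite Hf//; apply/negP.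
  left=> z; case: (ltP (z.1 ^+ 2 + z.2 ^+ 2) 1) => z1; first by rewrite Hf.
  have [s [s01 ->]] := polar_surj z1.
  rewrite fpt_bd//; last by rewrite /rad -sqrtr1 ler_wsqrtr.
  have := size_rel f; case: f hf => g [r rP] /= hf; rewrite size_cay_path => hr.
  have {hf hr rP} : (N + size (r : seq (gens P)) < wlen P g)%N.
    by apply: leq_ltn_trans hf; rewrite leq_add2l.
  elim: r g (_ * s) => [|a r IH] g u /= h.
    by have -> : path_pt (K := cayley P) g [::] u = vpt R (g : vert (cayley P)) by [];
      rewrite Hv; lia.
  have [h1 h2] := wlen_edge ((g, a) : dart (cayley P)); rewrite /tgt /= in h1 h2.
  rewrite path_pt_cons; case: ifP => _; last by apply: IH; rewrite /tgt /=; lia.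
  by rewrite He /tgt /=; split=> _; lia.
- by move=> g; rewrite Hv.
- by move=> d t /andP[t0 t1]; rewrite He; split=> [[h1 h2]|[? ?]//]; split; auto.
Qed.

Lemma compact_cdist_bounded (C : set X) : compact C ->
  exists N : nat, forall x, C x -> cdist x <= N%:R.
Proof.
move=> /compact_near_coveringP.
move=> /(_ nat \oo (fun N x => cdist x <= (N + (2 * max_rel + 2))%:R) _)[].
  move=> x _; pose far N := projT1 (cid (far_subcomplex N)).
  have [N nx] : exists N, ~ far N x.
    elim/realization_ind: x => [g|d t t01|f z z1].
    - exists (wlen P g); rewrite /far; case: cid => C' [_ h _ _] /=.
      by rewrite h ltnn.
    - exists (wlen P (org d)); rewrite /far; case: cid => C' [_ _ h _] /=.
      by rewrite h// ltnn => -[].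
    - exists (wlen P (fbase f)); rewrite /far; case: cid => C' [_ _ _ h] /=.
      by rewrite h// ltnNge leq_addr.
  exists (~` far N, [set n | (N <= n)%N]).
    split; last by exists N.
    apply: open_nbhs_nbhs; split=> //; apply: closed_openC.
    by rewrite /far; case: cid => C' [].
  move=> [y n] /= [ny Nn].
  apply: (@le_trans _ _ (N + (2 * max_rel + 2))%:R); last by rewrite ler_nat leq_add2r.
  move: ny; rewrite /far; case: cid => C' [_ hv he hf] /=.
  rewrite natrD (natrD _ (2 * max_rel) 2) natrM; have m0 := ler0n R max_rel; have N0 := ler0n R N.
  elim/realization_ind: y => [g|d t t01|f z z1].
  - by rewrite hv cdist_vpt => /negP; rewrite -leqNgt -(ler_nat R); lra.
  - rewrite he// cdist_ept// => h.
    have [l1 l2] := edge_height_near R d.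
    have [] : (wlen P (org d) <= N)%N \/ (wlen P (tgt d) <= N)%N by lia.
      by rewrite -(ler_nat R); move: l1; rewrite ler_norml; lra.
    by rewrite -(ler_nat R); move: l2; rewrite ler_norml; lra.
  - rewrite hf// cdist_fpt// => /negP; rewrite -leqNgt => h.
    have := size_rel f; case: f h => g [r rP] /= h; rewrite size_cay_path => hr.
    apply: le_trans (lerB (path_height_le g r) (lexx _)) _.
    have : (wlen P g + size r <= N + 2 * max_rel)%N.
      by rewrite mul2n -addnn addnA leq_add.
    by rewrite -(ler_nat R) (natrD _ N) natrM; lra.
move=> N _ /(_ N (leqnn N)) h.
by exists (N + (2 * max_rel + 2))%N.
Qed.

Definition cells_at g : set X :=
  [set vpt R (g : vert (cayley P))] `|`
  (\big[setU/set0]_(a : gens P) (ept (R := R) ((g, a) : dart (cayley P)) @` `[0, 1])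
   `|` \big[setU/set0]_(r : seq_sub (rels P))
     (fpt ((g, r) : face (cayley P)) @` (`[-1, 1] `*` `[-1, 1] : set (R * R)))).

Lemma compact_cells_at g : compact (cells_at g).
Proof.
apply: compactU; first exact: compact_set1.
apply: compactU; apply: bigsetU_compact => i _; apply: continuous_compact.
- exact/continuous_subspaceT/ept_continuous.
- exact: segment_compact.
- exact/continuous_subspaceT/fpt_continuous.
- by apply: compact_setX; exact: segment_compact.
Qed.

Lemma bigsetU_in (T : Type) (I : finType) (F : I -> set T) i x :
  F i x -> (\big[setU/set0]_i F i) x.
Proof. by move=> Fx; rewrite (bigD1 i)//=; left. Qed.

Lemma cdist_ball_compact (M : nat) : exists D : set X, compact D /\
  forall x, cdist x <= M%:R -> D x.
Proof.
(* A cell within distance M may be based one edge further out, whence the words of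
   length at most M + 1 for the base points. *)
exists (\big[setU/set0]_(k < M.+2) \big[setU/set0]_(w : k.-tuple (gens P))
  cells_at (wval (P := P) w)); split.
  by apply: bigsetU_compact => k _; apply: bigsetU_compact => w _;
    exact: compact_cells_at.
have inD g x : (wlen P g <= M.+1)%N -> cells_at g x ->
  (\big[setU/set0]_(k < M.+2) \big[setU/set0]_(w : k.-tuple (gens P))
    cells_at (wval (P := P) w)) x.
  move=> gM gx; rewrite -ltnS in gM; apply: (bigsetU_in (i := Ordinal gM)).
  by apply: (bigsetU_in (i := in_tuple (geod P g))); rewrite /= geodK.
elim/realization_ind => [g|[g a] t /andP[t0 t1]|[g r] z z1].
- by rewrite cdist_vpt ler_nat => gM; apply: (inD g); [lia|left].
- rewrite cdist_ept ?t0// => h; apply: (inD g).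
    have := edge_height_ge ((g, a) : dart (cayley P)); rewrite /= => h'.
    by rewrite -(ler_nat R) -natr1; lra.
  right; left; apply: (bigsetU_in (i := a)); exists t => //.
  by rewrite /= in_itv/= !ltW.
- rewrite cdist_fpt// => h; apply: (inD g).
    case: r h => [[|a r] rP]; first by have := rels_nonnil rP.
    rewrite /= big_cons lerBlDr ge_max => /andP[h _].
    have := edge_height_ge ((g, a) : dart (cayley P)); rewrite /= => h'.
    by rewrite -(ler_nat R) -natr1; lra.
  right; right; apply: (bigsetU_in (i := r)); exists z => //.
  rewrite /= !in_itv/=.
  split; nra.
Qed.

End Compact.

(** * Fillings as squares in the Cayley complex *)

Lemma continuous_within_after (S T U : topologicalType) (A : set T)
    (g : T -> U) (q : S -> T) :
  {within A, continuous g} -> continuous q -> (forall x, A (q x)) ->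
  continuous (fun x => g (q x)).
Proof.
move=> /subspace_continuousP cg cq Aq x W /(cg _ (Aq x)) gW.
have {gW} := cq x _ gW; rewrite /nbhs /=.
by apply: filterS => y; apply; exact: Aq.
Qed.

Section Clamp.
Variable R : realType.
Implicit Types t : R.

Definition clamp t : R := Num.max 0 (Num.min 1 t).

Lemma clamp_bd t : 0 <= clamp t <= 1.
Proof. by rewrite /clamp le_max lexx ge_max ler01 ge_min lexx. Qed.

Lemma clamp_id t : 0 <= t <= 1 -> clamp t = t.
Proof. by move=> /andP[t0 t1]; rewrite /clamp (min_idPr t1) (max_idPr t0). Qed.

Lemma clamp_le0 t : t <= 0 -> clamp t = 0.
Proof. by move=> t0; apply/max_idPl; rewrite ge_min t0 orbT. Qed.

Lemma clamp_ge1 t : 1 <= t -> clamp t = 1.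
Proof. by move=> t1; rewrite /clamp (min_idPl t1); apply/max_idPr. Qed.

Lemma clamp_continuous : continuous clamp.
Proof.
apply: continuous_maxr; first exact: continuous_cst.
apply: continuous_minr; first exact: continuous_cst.
by move=> t; exact: cvg_id.
Qed.

End Clamp.

Section Filling.
Variables (R : realType) (G : groupType) (P : presentation G).
Local Notation X := (realization R (cayley P)).

Section Diagram.
Variables (w : seq (gens P)) (D : vk_diagram R w).

(** The outer annulus lies in the complement of the diagram and accumulates on its
   inner circle, where it reads the boundary path. *)
Lemma bpath_in_boundary (s : R) : 0 <= s <= 1 ->
  vk_boundary (path_pt (vk_base D) (vk_bpath D) ((size (vk_bpath D))%:R * s)).
Proof.
have [h [/subspace_continuousP ch hbij hper hbd _]] := vk_bpath_ccw D.
move=> s01; rewrite /vk_boundary /= -hbd//.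
have [s' s'01 ->] : exists2 s', 0 <= s' < 1 & h (1, s) = h (1, s').
  have [s0 s1] := andP s01; case: (ltP s 1) => s1'.
    by exists s => //; apply/andP.
  exists 0; first by rewrite lexx ltr01.
  by rewrite hper//; congr (h (_, _)); apply/eqP; rewrite eq_le s1.
have [s0 s1] := andP s'01.
move=> B /(ch (1, s')) [].
  by split; rewrite /= in_itv/= ?lexx// s0 ltW.
case=> Q1 Q2 [/= /nbhs_ballP[e /= e0 Q1e] /nbhs_singleton Q2s] QB.
exists (h (1 + e / 2, s')); split.
  have [hfun _ _] := hbij.
  apply: hfun; split; rewrite /= in_itv/= ?s0// andbT; lra.
apply: (QB (1 + e / 2, s')); last first.
  by split; rewrite /= in_itv/= ?s0 ?ltW//; lra.
split=> //=; apply: Q1e; rewrite /ball /= opprD addrA subrr add0r normrN ger0_norm; lra.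
Qed.

Variables (pr : realization R D -> X) (hpr : vk_projection pr).

Lemma projection_continuous : continuous pr.
Proof.
have [mv [md [mf [_ _ _ [_ pe pf]]]]] := hpr.
apply/continuousP => U [Ue Uf].
suff : cw_open (pr @^-1` U) by [].
split=> [d|f].
  apply: (eq_ind _ (fun A : set R => open A) (Ue (md d))).
  by apply/seteqP; split=> t; rewrite /= pe.
apply: (eq_ind _ (fun A : set (R * R) => open A) (Uf (mf f))).
by apply/seteqP; split=> t; rewrite /= pf.
Qed.

Lemma projection_bpath u :
  pr (path_pt (vk_base D) (vk_bpath D) u) =
  path_pt (K := cayley P) (cay_id P) (cay_path (cay_id P) w) u.
Proof.
have [mv [md [mf [mb mdE _ [pv pe _]]]]] := hpr.
have mt d : tgt (md d) = mv (tgt d).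
  by rewrite /tgt; have [_ <- _] := mdE d; have [-> _ _] := mdE (dinv d).
have prp p v u' : pr (path_pt v p u') = path_pt (mv v) (map md p) u'.
  elim: p v u' => [|d p IH] v u'; first exact: pv.
  by rewrite [map _ _]/= !path_pt_cons; case: ifP => _; [exact: pe|rewrite IH mt].
have ep p v v' : epath v p v' -> epath (mv v) (map md p) (mv v').
  elim: p v => [|d p IH] v /=; first by move=> ->.
  case=> <- /IH h; split; first by have [] := mdE d.
  by have := h; rewrite -/(tgt d) -mt.
rewrite prp mb.
have := ep _ _ _ (vk_bpath_closed D); rewrite mb => /epath_cay[e _]; rewrite e.
rewrite -map_comp; congr (path_pt (K := cayley P) _ (cay_path _ _) _).
rewrite -[RHS](vk_bpath_lab D).
by apply: eq_map => d /=; have [] := mdE d.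
Qed.

End Diagram.

(** All that is kept of a diagram and its combing is their image in the Cayley complex,
   parametrized by the boundary loop and by time; in this form fillings of different
   words can be compared.  The sides s = 0 and s = 1 are constant because a
   1-combing fixes the base point. *)
Lemma filling_square (f : R -> R) (w : seq (gens P)) :
  extrinsic_tame_filling P f -> wval w = 1%g ->
  exists F : R * R -> X,
    [/\ continuous F,
        forall s, F (s, 0) = vpt R (cay_id P),
        forall t, F (0, t) = vpt R (cay_id P) /\ F (1, t) = vpt R (cay_id P),
        forall s, 0 <= s <= 1 -> F (s, 1) =
          path_pt (K := cayley P) (cay_id P) (cay_path (cay_id P) w) ((size w)%:R * s) &
        forall s t t', 0 <= s <= 1 -> 0 <= t -> t < t' -> t' <= 1 ->
          cdist (F (s, t)) <= f (cdist (F (s, t')))].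
Proof.
move=> [_ hf] /hf[D [pr [Psi [hpr [cPsi Psi01 Psi_base _] tPsi]]]].
pose c (s : R) := path_pt (vk_base D) (vk_bpath D) ((size (vk_bpath D))%:R * s).
have cc : continuous c.
  apply: (continuous_after (path_pt_continuous (vk_bpath_closed D))).
  exact: mulrl_continuous.
have cZ s : 0 <= s <= 1 -> vk_boundary (c s) by exact: bpath_in_boundary.
have sw : size (vk_bpath D) = size w by rewrite -[RHS](congr1 size (vk_bpath_lab D)) size_map.
have c0 : c 0 = vpt R (vk_base D).
  by rewrite /c mulr0; apply: path_pt_le0 (vk_bpath_closed D) _.
have c1 : c 1 = vpt R (vk_base D).
  by rewrite /c mulr1; apply: path_pt_ge (vk_bpath_closed D) _.
have Zb : vk_boundary (vpt R (vk_base D)).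
  by rewrite -c0; apply: cZ; rewrite lexx ler01.
have prb : pr (vpt R (vk_base D)) = vpt R (cay_id P).
  by have [mv [md [mf [<- _ _ [-> _ _]]]]] := hpr.
exists (fun z => pr (Psi (c (clamp z.1), clamp z.2))); split=> /=.
- apply: continuous_after (projection_continuous hpr) _.
  apply: (continuous_within_after cPsi).
    apply: continuous_pairing; last first.
      exact: (continuous_after (@clamp_continuous R) (@continuous_proj2 _ _)).
    apply: (continuous_after cc).
    exact: (continuous_after (@clamp_continuous R) (@continuous_proj1 _ _)).
  move=> z; split; first by apply: cZ; exact: clamp_bd.
  by rewrite /= in_itv; exact: clamp_bd.
- move=> s; rewrite (clamp_le0 (lexx 0)).
  by have [-> _] := Psi01 _ (cZ _ (clamp_bd s)).
- move=> t; rewrite (clamp_le0 (lexx 0)) (clamp_ge1 (lexx 1)) c0 c1.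
  by rewrite (Psi_base Zb _ (clamp_bd t)).
- move=> s s01; rewrite clamp_id// (clamp_ge1 (lexx 1)).
  by have [_ ->] := Psi01 _ (cZ _ s01); rewrite /c projection_bpath// sw.
- move=> s t t' s01 t0 tt' t'1; rewrite !clamp_id//; try lra.
  exact: (tPsi _ _ _ _ _ (cZ _ s01) t0 tt' t'1 (cdist_coarse _) (cdist_coarse _)).
Qed.

End Filling.

(** * The combing of the Cayley complex *)

Lemma continuous_if_le (R : realType) (T Y : topologicalType) (phi : T -> R)
    (f g : T -> Y) (c : R) : continuous phi -> continuous f -> continuous g ->
  (forall x, phi x = c -> f x = g x) ->
  continuous (fun x => if phi x <= c then f x else g x).
Proof.
move=> cphi /continuous_closedP cf /continuous_closedP cg fg.
apply/continuous_closedP => A cA.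
apply: (eq_ind _ (fun B : set T => closed B) (closedU
  (closedI (closed_preimage cphi (@closed_le _ c)) (cf A cA))
  (closedI (closed_preimage cphi (@closed_ge _ c)) (cg A cA)))).
apply/seteqP; split=> x /=; case: leP => h.
- by case=> -[h1 h2] //; rewrite fg//; apply/eqP; rewrite eq_le h.
- by case=> -[h1 h2] //; exfalso; lra.
- by left.
- by right; rewrite ltW.
Qed.

Lemma ept_clamp (R : realType) (K : complex2) (d : dart K) (u : R) :
  ept d (clamp u) = ept d u.
Proof.
case: (leP u 0) => u0; first by rewrite clamp_le0// !ept_org.
case: (leP 1 u) => u1; first by rewrite clamp_ge1// !ept_tgt.
by rewrite clamp_id// !ltW.
Qed.

Lemma path_pt_skel1 (R : realType) (K : complex2) (v : vert K) p (u : R) :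
  skel1 (path_pt v p u).
Proof.
elim: p v u => [|d p IH] v u; first by left; exists v.
by rewrite path_pt_cons; case: ifP => _ //; right; exists d, u.
Qed.

Section Orientation.
Variable K : complex2.
Implicit Types d : dart K.

(** A choice of one of the two orientations of each edge: an edge and its reverse have
   to be combed by the same filling. *)
Definition positive d : bool := d == choose (pred2 d (dinv d)) d.

Lemma positive_inv d : positive (dinv d) = ~~ positive d.
Proof.
have e : choose (pred2 (dinv d) (dinv (dinv d))) (dinv d) =
         choose (pred2 d (dinv d)) d.
  rewrite (@choose_id _ (pred2 d (dinv d)) d (dinv d)) /= ?eqxx ?orbT//.
  by apply: eq_choose => x /=; rewrite dinvK orbC.
rewrite /positive e.
have : pred2 d (dinv d) (choose (pred2 d (dinv d)) d).
  by apply: chooseP; rewrite /= eqxx.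
have ne : (d == dinv d) = false by apply/eqP => h; apply: (@dinv_neq _ d).
by case/orP => /eqP ->; rewrite eqxx ?ne// eq_sym ne.
Qed.

End Orientation.

Section Combing.
Variables (R : realType) (G : groupType) (P : presentation G).
Variables (f : R -> R) (hf : extrinsic_tame_filling P f).
Local Notation X := (realization R (cayley P)).
Local Notation id0 := (cay_id P).
Implicit Types (g : G) (d : dart (cayley P)) (s t u : R).

Definition geod_path g : seq (dart (cayley P)) := cay_path id0 (geod P g).

Lemma geod_epath g : epath (K := cayley P) id0 (geod_path g) g.
Proof. by have := cay_epath id0 (geod P g); rewrite geodK mul1g. Qed.

Lemma size_geod_path g : size (geod_path g) = wlen P g.
Proof. exact: size_cay_path. Qed.

(** The pause at the identity until time 1/2 makes this the limit of [sweep] at the end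
   of an edge, where the first half is a constant side of the square. *)
Definition vertex_comb g t : X :=
  path_pt id0 (geod_path g) ((wlen P g)%:R * clamp (2 * t - 1)).

Definition tri_path d : seq (dart (cayley P)) := cay_path id0 (triangle d.1 d.2).

Definition tri_len d : R := (size (triangle d.1 d.2))%:R.

Lemma tri_lenE d : tri_len d = (wlen P (org d))%:R + 1 + (wlen P (tgt d))%:R.
Proof. by rewrite /tri_len size_triangle !natrD. Qed.

Lemma tri_epath d : epath (K := cayley P) id0 (tri_path d) id0.
Proof.
by have := cay_epath id0 (triangle d.1 d.2); rewrite triangle_val mulg1.
Qed.

Lemma tri_pathE d : tri_path d =
  geod_path (org d) ++ d :: rev (map (@dinv _) (geod_path (tgt d))).
Proof.
rewrite /tri_path /triangle cay_path_cat geodK mul1g /=.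
rewrite -cay_path_inv geodK mul1g; congr (_ ++ _ :: _).
by case: d.
Qed.

Lemma tri_epath2 d : epath (K := cayley P) (org d)
  (d :: rev (map (@dinv _) (geod_path (tgt d)))) id0.
Proof. by split=> //; apply: epath_rev; exact: geod_epath. Qed.

Lemma tri_pt_out d u : u <= (wlen P (org d))%:R ->
  path_pt id0 (tri_path d) u = path_pt id0 (geod_path (org d)) u :> X.
Proof.
move=> un; rewrite tri_pathE (path_pt_cat _ (geod_epath _) (tri_epath2 d)).
by rewrite size_geod_path un.
Qed.

Lemma tri_pt_edge d u : 0 <= u <= 1 ->
  path_pt id0 (tri_path d) ((wlen P (org d))%:R + u) = ept d u :> X.
Proof.
move=> /andP[u0 u1]; rewrite tri_pathE.
rewrite (path_pt_cat _ (geod_epath _) (tri_epath2 d)) size_geod_path.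
rewrite addrAC subrr add0r path_pt_cons u1; case: leP => // h.
rewrite (path_pt_ge (geod_epath _)); first by rewrite ept_org//; lra.
by rewrite size_geod_path lerDl.
Qed.

Lemma tri_pt_back d u : 0 <= u <= (wlen P (tgt d))%:R ->
  path_pt id0 (tri_path d) (tri_len d - u) =
  path_pt id0 (geod_path (tgt d)) u :> X.
Proof.
move=> u01; rewrite tri_pathE tri_lenE.
rewrite (path_pt_cat _ (geod_epath _) (tri_epath2 d)) size_geod_path.
rewrite leNgt ifN; last by rewrite negbK; lra.
rewrite (path_pt_cons_ge1 (tri_epath2 d)); last by lra.
rewrite (path_pt_rev (geod_epath _)) ?size_geod_path; last by lra.
by congr path_pt; lra.
Qed.

Definition edge_square d : R * R -> X :=
  projT1 (cid (filling_square hf (triangle_val (d.1 : G) d.2))).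

(** For a point u of an edge: during the first half the path of the square to the point
   at parameter u of the triangle, then the triangle from there to the point u of
   the edge, which has parameter wlen (org d) + u. *)
Definition sweep d (z : R * R) : X :=
  let u := clamp z.1 in
  if z.2 <= 1 / 2 then edge_square d (u, 2 * z.2)
  else path_pt id0 (tri_path d) (tri_len d * u +
    clamp (2 * z.2 - 1) * ((wlen P (org d))%:R + u - tri_len d * u)).

Lemma sweep_continuous d : continuous (sweep d).
Proof.
have c1 : continuous (fun z : R * R => clamp z.1).
  exact: (continuous_after (@clamp_continuous R) (@continuous_proj1 _ _)).
have c2 : continuous (fun z : R * R => 2 * z.2).
  exact: (continuous_after (@mulrl_continuous _ 2) (@continuous_proj2 _ _)).
have c3 : continuous (fun z : R * R => clamp (2 * z.2 - 1)).
  apply: (continuous_after (@clamp_continuous R)).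
  by apply: (continuous_add c2); exact: continuous_cst.
have c4 : continuous (fun z : R * R => tri_len d * clamp z.1).
  exact: (continuous_after (@mulrl_continuous _ _) c1).
rewrite /sweep /edge_square; case: cid => F [cF _ _ F1 _] /=.
apply: continuous_if_le; first exact: continuous_proj2.
- by apply: (continuous_after cF); exact: continuous_pairing.
- apply: (continuous_after (path_pt_continuous (tri_epath d))).
  apply: (continuous_add c4); apply: (continuous_mul c3).
  apply: continuous_add; last exact: continuous_opp.
  by apply: continuous_add => //; exact: continuous_cst.
- move=> [u t] /= ->.
  have -> : 2 * (1 / 2) = 1 :> R by lra.
  by rewrite F1 ?clamp_bd// subrr (clamp_le0 (lexx 0)) mul0r addr0.
Qed.

Lemma sweep_start d u : sweep d (u, 0) = vpt R id0.
Proof.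
rewrite /sweep /= ifT; last by lra.
by rewrite mulr0 /edge_square; case: cid => F [].
Qed.

Lemma sweep_end d u : sweep d (u, 1) = ept d u.
Proof.
rewrite /sweep /= ifN; last by rewrite -ltNge; lra.
rewrite (@clamp_ge1 _ (2 * 1 - 1)); last by lra.
by rewrite mul1r addrC subrK tri_pt_edge ?clamp_bd// ept_clamp.
Qed.

Lemma sweep_org d u t : u <= 0 -> sweep d (u, t) = vertex_comb (org d) t.
Proof.
move=> u0; rewrite /sweep /= (clamp_le0 u0) mulr0 add0r addr0 subr0 /vertex_comb.
case: leP => ht.
  rewrite clamp_le0 ?mulr0; last by lra.
  rewrite (path_pt_le0 (geod_epath _))//.
  by rewrite /edge_square; case: cid => F [_ _ h _ _] /=; have [] := h (2 * t).
have /andP[v0 v1] := clamp_bd (2 * t - 1).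
rewrite tri_pt_out mulrC// ler_piMr//.
Qed.

Lemma sweep_tgt d u t : 1 <= u -> sweep d (u, t) = vertex_comb (tgt d) t.
Proof.
move=> u1; rewrite /sweep /= (clamp_ge1 u1) mulr1 /vertex_comb.
case: leP => ht.
  rewrite [in RHS]clamp_le0 ?mulr0; last by lra.
  rewrite (path_pt_le0 (geod_epath _))//.
  by rewrite /edge_square; case: cid => F [_ _ h _ _] /=; have [] := h (2 * t).
have /andP[v0 v1] := clamp_bd (2 * t - 1).
rewrite -tri_pt_back; first by congr path_pt; rewrite tri_lenE; ring.
by rewrite mulr_ge0//= ler_piMr.
Qed.

Lemma vertex_comb_continuous g : continuous (vertex_comb g).
Proof.
apply: (continuous_after (path_pt_continuous (geod_epath g))).
apply: (continuous_after (@mulrl_continuous _ _)).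
apply: (continuous_after (@clamp_continuous R)).
by apply: continuous_add; [exact: mulrl_continuous|exact: continuous_cst].
Qed.

Lemma clamp_homo s t : s <= t -> clamp s <= clamp t.
Proof.
move=> st; rewrite /clamp ge_max le_max lexx /= le_max; apply/orP; right.
by rewrite le_min ge_min lexx /= ge_min st orbT.
Qed.

Lemma vertex_comb_tame g s t : s <= t ->
  cdist (vertex_comb g s) <= cdist (vertex_comb g t) + 4.
Proof.
move=> st; set n : R := (wlen P g)%:R.
have n0 : 0 <= n by exact: ler0n.
have bd v : 0 <= n * clamp v <= n.
  by have /andP[v0 v1] := clamp_bd v; rewrite mulr_ge0//= ler_piMr.
have := cdist_geod (bd (2 * s - 1)); have := cdist_geod (bd (2 * t - 1)).
have : n * clamp (2 * s - 1) <= n * clamp (2 * t - 1).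
  by rewrite ler_wpM2l// clamp_homo//; lra.
by rewrite /vertex_comb !ler_norml; lra.
Qed.

(** The motion is monotone towards a point of the edge, which is the middle of the
   triangle up to a bounded error, whereas the distance from the identity is, up to 2,
   the distance to the nearer end of the loop. *)
Lemma tri_pt_tame d u v v' (m := fun v => tri_len d * u +
    v * ((wlen P (org d))%:R + u - tri_len d * u)) :
  0 <= u <= 1 -> 0 <= v -> v <= v' -> v' <= 1 ->
  cdist (path_pt id0 (tri_path d) (m v) : X) <=
  cdist (path_pt id0 (tri_path d) (m v') : X) + 5.
Proof.
move=> u01 v0 vv' v'1.
have [d1 d2] := wlen_edge d.
have {}d1 : ((wlen P (org d))%:R : R) <= (wlen P (tgt d))%:R + 1.
  by rewrite natr1 ler_nat.
have {}d2 : ((wlen P (tgt d))%:R : R) <= (wlen P (org d))%:R + 1.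
  by rewrite natr1 ler_nat.
have n0 := ler0n R (wlen P (org d)); have k0 := ler0n R (wlen P (tgt d)).
have Lu : 0 <= tri_len d * u <= tri_len d.
  by have [u0 u1] := andP u01; rewrite mulr_ge0 ?ler_piMr//; exact: ler0n.
have mE w : m w = tri_len d * u + w * ((wlen P (org d))%:R + u - tri_len d * u).
  by [].
have bd w : 0 <= w <= 1 -> 0 <= m w <= tri_len d.
  rewrite mE; move: Lu (tri_lenE d).
  move: (tri_len d * u) (tri_len d) => p L p0 L0 w01; apply/andP; split; nra.
have mid : Num.min (m v) (tri_len d - m v) <=
           Num.min (m v') (tri_len d - m v') + 1.
  have [h|h] : (m v <= m v' <= (wlen P (org d))%:R + u) \/
               ((wlen P (org d))%:R + u <= m v' <= m v).
    rewrite !mE; move: (tri_len d * u) => p.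
    by case: (leP p ((wlen P (org d))%:R + u)) => hp; [left|right];
      apply/andP; split; nra.
  - move: (tri_lenE d) h; move: (m v) (m v') (tri_len d) => p q L L0 /andP[h1 h2].
    by case: (leP p _) => h3; case: (leP q _) => h4; lra.
  - move: (tri_lenE d) h; move: (m v) (m v') (tri_len d) => p q L L0 /andP[h1 h2].
    by case: (leP p _) => h3; case: (leP q _) => h4; lra.
have := @cdist_triangle _ P R (org d) d.2 (m v) (bd _ _).
have := @cdist_triangle _ P R (org d) d.2 (m v') (bd _ _).
rewrite -/(tri_path d) -/(tri_len d) !ler_norml.
move=> /(_ ltac:(lra)) h1 /(_ ltac:(lra)) h2; lra.
Qed.

(** On the first half f bounds the past of a path.  A path seen in its second half at
   distance at most N left the square at distance at most N + 5, so f (N + 5) bounds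
   its first half. *)
Lemma sweep_tame (N : nat) : exists M : nat, forall d u s t,
  0 <= s -> s <= t -> t <= 1 ->
  cdist (sweep d (u, t)) <= N%:R -> cdist (sweep d (u, s)) <= M%:R.
Proof.
have [[fq fmono] _] := hf.
have [k1 fk1] := fq _ (quarters_nat R N).
have [k2 fk2] := fq _ (quarters_nat R (N + 5)).
exists (N + 5 + k1 + k2)%N => d u s t s0 st t1 hN.
have K1 := ler0n R k1; have K2 := ler0n R k2; have N0 := ler0n R N.
rewrite 2!natrD (natrD _ N 5).
have [<-|ne] := eqVneq t s; first by lra.
have {st ne} st : s < t by rewrite lt_neqAle eq_sym ne.
have u01 := clamp_bd u.
have fN x : cdist (x : X) <= N%:R -> f (cdist x) <= k1%:R.
  move=> h; apply: (@le_trans _ _ (k1%:R / 4)); last by lra.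
  by rewrite -fk1; apply: fmono => //; [exact: cdist_quarters|exact: quarters_nat].
have fN5 x : cdist (x : X) <= N%:R + 5 -> f (cdist x) <= k2%:R.
  move=> h; apply: (@le_trans _ _ (k2%:R / 4)); last by lra.
  rewrite -fk2; apply: fmono; rewrite ?natrD//; first exact: cdist_quarters.
  by rewrite -natrD; exact: quarters_nat.
move: hN; rewrite /sweep /=; case: (leP t (1 / 2)) => ht; case: (leP s (1 / 2)) => hs.
- move=> hN; apply: (@le_trans _ _ k1%:R); last by lra.
  apply: le_trans (fN _ hN).
  rewrite /edge_square; case: cid => F [_ _ _ _ tF] /=; apply: tF => //; lra.
- by lra.
- move=> hN; set x := path_pt id0 (tri_path d) (tri_len d * clamp u) : X.
  have hx : cdist x <= N%:R + 5.
    have /andP[c0 c1] := clamp_bd (2 * t - 1).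
    have := tri_pt_tame d u01 (lexx 0) c0 c1; rewrite mul0r addr0 => h5.
    by apply: le_trans h5 _; rewrite lerD2r.
  rewrite /edge_square; case: cid => F [_ _ _ F1 tF] /=.
  have xF : x = F (clamp u, 1) by rewrite F1.
  move: hs; rewrite le_eqVlt => /orP[/eqP ->|hs].
    by rewrite (_ : 2 * (1 / 2) = 1) -?xF; lra.
  apply: (@le_trans _ _ k2%:R); last by lra.
  by apply: le_trans (fN5 _ hx); rewrite xF; apply: tF => //; lra.
- move=> hN.
  have /andP[c0 _] := clamp_bd (2 * s - 1); have /andP[_ c1] := clamp_bd (2 * t - 1).
  have st' : 2 * s - 1 <= 2 * t - 1 by lra.
  apply: le_trans (tri_pt_tame d u01 c0 (clamp_homo st') c1) _.
  by apply: le_trans (lerD hN (lexx 5)) _; lra.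
Qed.

Lemma combing_ex : exists Psi : X * R -> X,
  [/\ forall g t, Psi (vpt R (g : vert (cayley P)), t) = vertex_comb g t,
      forall d u t, positive d -> Psi (ept d u, t) = sweep d (u, t) &
      forall d u t, ~~ positive d ->
        Psi (ept d u, t) = sweep (dinv d) (1 - u, t)].
Proof.
have [d u u0|d u|H [Hv He _]] := @realization_ext R (cayley P) (R -> X)
  (fun g => vertex_comb g)
  (fun d u t => if positive d then sweep d (u, t) else sweep (dinv d) (1 - u, t))
  (fun _ _ _ => vpt R id0).
- apply/funext => t; case: ifP => _; first exact: sweep_org.
  by rewrite sweep_tgt ?/tgt ?dinvK//; lra.
- apply/funext => t; rewrite positive_inv dinvK subKr; by case: (positive d).
- exists (fun z => H z.1 z.2); split=> [g t|d u t dp|d u t /negbTE dp] /=.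
  + by rewrite Hv.
  + by rewrite He dp.
  + by rewrite He dp.
Qed.

(** Closed cells of dimensions 0 and 1 are treated alike, as images of [0,1] under e.
   The connecting path first moves along the cell at time 0 and then forward in
   time. *)
Lemma tame_combable_cell (Psi : X * R -> X) (e : R -> X) (C : set X) :
  continuous e -> (forall u, 0 <= u <= 1 -> skel1 (e u)) -> compact C ->
  (forall x, skel1 x -> Psi (x, 0) = vpt R id0) ->
  (forall N : nat, exists M : nat, forall x s t, skel1 x ->
     0 <= s -> s <= t -> t <= 1 ->
     cdist (Psi (x, t)) <= N%:R -> cdist (Psi (x, s)) <= M%:R) ->
  exists D : set X, compact D /\
    let S := (Psi @^-1` D) `&` ((e @` `[0, 1]) `*` `[0, 1]) in
    exists2 x, S x &
      (Psi @^-1` C) `&` ((e @` `[0, 1]) `*` `[0, 1]) `<=` path_component R S x.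
Proof.
move=> ce se cC Psi0 Psit.
have [N CN] := compact_cdist_bounded cC.
have [M hM] := Psit N.
have [D [cD DM]] := cdist_ball_compact R P M.
exists D; split=> // S.
have D0 x : skel1 x -> D (Psi (x, 0)).
  by move=> sx; rewrite Psi0//; apply: DM; rewrite cdist_vpt wlen1.
have i0 : 0 <= (0 : R) <= 1 by rewrite lexx ler01.
exists (e 0, 0).
  split; first exact/D0/se.
  by split; rewrite /= ?in_itv//; exists 0; rewrite //= in_itv.
move=> [x t] [/= Ct [[u /= + eu]]]; rewrite !in_itv /= => u01 t01.
rewrite -{x}eu in Ct *.
exists (fun s => (e (clamp (2 * s) * u), clamp (2 * s - 1) * t)).
have [u0 u1] := andP u01; have [t0 t1] := andP t01.
have bd (c v : R) : 0 <= v <= 1 -> 0 <= clamp c * v <= 1.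
  move=> /andP[v0 v1]; have /andP[c0 c1] := clamp_bd c.
  by rewrite mulr_ge0//= mulr_ile1.
split.
- apply: continuous_subspaceT; apply: continuous_pairing.
    apply: (continuous_after ce).
    apply: continuous_mul; last exact: continuous_cst.
    exact: (continuous_after (@clamp_continuous R) (@mulrl_continuous _ _)).
  apply: continuous_mul; last exact: continuous_cst.
  apply: (continuous_after (@clamp_continuous R)).
  by apply: continuous_add; [exact: mulrl_continuous|exact: continuous_cst].
- by rewrite mulr0 (clamp_le0 (lexx 0)) clamp_le0 ?mul0r//; lra.
- by rewrite !clamp_ge1 ?mul1r//; lra.
- move=> s s01; split; last first.
    split; rewrite /= ?in_itv/=; last exact: bd.
    by exists (clamp (2 * s) * u) => //; rewrite /= in_itv; exact: bd.
  rewrite /=; case: (leP s (1 / 2)) => hs.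
    rewrite [clamp (_ - _)]clamp_le0 ?mul0r; last by lra.
    by apply: D0; apply: se; exact: bd.
  rewrite (@clamp_ge1 _ (2 * s)) ?mul1r; last by lra.
  apply: DM; apply: (hM _ _ t); [exact: se| | |by []|exact: CN Ct].
    by have /andP[] := bd (2 * s - 1) t t01.
  by rewrite ler_piMl//; have /andP[] := clamp_bd (2 * s - 1).
Qed.

Lemma combable : tame_combable R G.
Proof.
have [Psi [Pv Pp Pn]] := combing_ex.
have Psi0 x : skel1 x -> Psi (x, 0) = vpt R id0.
  case=> [[g ->]|[d [u ->]]].
    rewrite Pv /vertex_comb clamp_le0; last by lra.
    by rewrite mulr0 (path_pt_le0 (geod_epath g)).
  by have [dp|dp] := boolP (positive d); rewrite ?(Pp _ _ _ dp) ?(Pn _ _ _ dp) sweep_start.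
have Psi1 x : skel1 x -> Psi (x, 1) = x.
  case=> [[g ->]|[d [u ->]]].
    rewrite Pv /vertex_comb clamp_ge1; last by lra.
    by rewrite mulr1 (path_pt_ge (geod_epath g)) ?size_geod_path.
  have [dp|dp] := boolP (positive d); rewrite ?(Pp _ _ _ dp) ?(Pn _ _ _ dp) sweep_end//.
  by rewrite -ept_inv.
exists P, Psi; split.
  split.
  - apply: skel1_cylinder_continuous => [g|d].
      rewrite (_ : (fun t => _) = vertex_comb g); first exact: vertex_comb_continuous.
      by apply/funext => t; rewrite Pv.
    have [dp|dp] := boolP (positive d).
      rewrite (_ : (fun z => _) = sweep d); first exact: sweep_continuous.
      by apply/funext => -[u t]; rewrite Pp.
    rewrite (_ : (fun z => _) = fun z : R * R => sweep (dinv d) (1 - z.1, z.2)).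
      apply: (continuous_after (@sweep_continuous _)); apply: continuous_pairing.
        apply: continuous_add; first exact: continuous_cst.
        by apply: continuous_opp; exact: continuous_proj1.
      exact: continuous_proj2.
    by apply/funext => -[u t]; rewrite Pn.
  - by move=> x sx; rewrite Psi0// Psi1.
  - move=> _ t t01; rewrite Pv /vertex_comb /geod_path geod1.
    by [].
  - by move=> g _ t _; rewrite Pv; exact: path_pt_skel1.
have Psit (N : nat) : exists M : nat, forall x s t, skel1 x ->
    0 <= s -> s <= t -> t <= 1 ->
    cdist (Psi (x, t)) <= N%:R -> cdist (Psi (x, s)) <= M%:R.
  have [M hM] := sweep_tame N; exists (M + (N + 4))%N => x s t sx s0 st t1 h.
  have M0 := ler0n R M; have N0 := ler0n R N; rewrite natrD (natrD _ N 4).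
  case: sx h => [[g ->]|[d [u ->]]].
    by rewrite !Pv => h; have := vertex_comb_tame g st; lra.
  have [dp|dp] := boolP (positive d); rewrite ?(Pp _ _ _ dp) ?(Pn _ _ _ dp) => h;
    by have := hM _ _ _ _ s0 st t1 h; lra.
move=> tau [[g ->]|[d ->]] C cC.
  have -> : [set vpt R g] = (fun _ : R => vpt R g) @` `[0, 1].
    apply/seteqP; split=> x /=; last by case.
    by move=> ->; exists 0 => //; rewrite /= in_itv/= lexx ler01.
  apply: tame_combable_cell => //; first exact: continuous_cst.
  by move=> _ _; left; exists g.
apply: tame_combable_cell => //; first exact: ept_continuous.
by move=> u _; right; exists d, u.
Qed.

End Combing.

Theorem corollary4p5 (R : realType) (G : groupType) (P : presentation G)
    (f : R -> R) (hf : extrinsic_tame_filling P f) :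
  tame_combable R G.
Proof. exact: combable hf. Qed.
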